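(* Let $A$ be a Nakayama algebra, let $S$ be a simple $A$-module and let $t\ge 0$ be an integer. If $e(S)=2t$, then $h(S)=\gamma^t\phi(S)$. If $e(S)=2t+1$, then $h(S)=\gamma^t\tau(S)$.
   Context: A Nakayama algebra is an artin algebra such that all indecomposable modules are serial (i.e. have a unique composition series). Modules are left $A$-modules; $\operatorname{pd}$ denotes projective dimension; $PS$ is a projective cover and $IS$ an injective envelope of $S$; $\Omega M$ is the kernel of a projective cover of $M$ and $\Omega^z$ is the $z$-th iterate ($\Omega^0M=M$). For $S$ simple, $e(S)=\min\{\operatorname{pd} S,\operatorname{pd} IS\}$ (this is finite for a Nakayama algebra), $NS=S$ if $e(S)$ is odd, $NS=IS$ if $e(S)$ is even, and $h(S)=\operatorname{top}\Omega^{e(S)}NS$ (a simple module). $\tau=D\operatorname{Tr}$ is the Auslander-Reiten translation, applied only to indecomposable non-projective modules (for a Nakayama algebra it sends simple non-projective modules to simple modules). On simple modules put $\phi(S)=\operatorname{top} IS$, and $\gamma(S)=\tau\operatorname{soc} PS$, the latter being defined only if $\operatorname{soc} PS$ is not projective; $\gamma^t$ is the $t$-fold iterate. Equality of simple modules means isomorphism. *)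

(* Defs.v *)
From HB Require Import structures.
From mathcomp Require Import all_boot all_order all_algebra.
From mathcomp Require Import boolp classical_sets functions constructive_ereal.

Set Implicit Arguments.
Unset Strict Implicit.
Unset Printing Implicit Defensive.

Import Order.TTheory GRing.Theory Num.Theory.
Local Open Scope classical_set_scope.
Local Open Scope ring_scope.

(* Left modules over A are [lmodType A], right modules are [lmodType A^c], with
   [A^c] the converse ring.  Submodules are classical sets.  Constructions that
   are determined only up to isomorphism (projective covers, injective
   envelopes, syzygies, tops, socles, D, Tr, ...) are given as relations
   between modules, all of which are invariant under isomorphism. *)

Section Modules.
Context {A : nzRingType}.
Implicit Types K M N P Q T X Y : lmodType A.

Definition submodule M (U : set M) : Prop := submod_closed [in U].

Definition fin_gen M : Prop :=
  exists (n : nat) (v : 'I_n -> M),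
    forall x, exists a : 'I_n -> A, x = \sum_(i < n) a i *: v i.

Definition artinian_module M : Prop :=
  forall U : nat -> set M,
    (forall n, submodule (U n)) -> (forall n, U n.+1 `<=` U n) ->
    exists n, forall m, (n <= m)%N -> U m = U n.

Definition isomorphic M N : Prop := exists f : {linear M -> N}, bijective f.

Definition kernel M N (f : {linear M -> N}) : set M := f @^-1` [set 0].

Definition injective_map M N (f : {linear M -> N}) : Prop := injective f.

Definition surjective_map M N (f : {linear M -> N}) : Prop := range f = setT.

Definition sum_set M (U V : set M) : set M := [set u + v | u in U & v in V].

(* for submodules U and V of M: U is contained in V and V/U is simple *)
Definition simple_factor M (U V : set M) : Prop :=
  U `<` V /\
  forall W, submodule W -> U `<=` W -> W `<=` V -> W = U \/ W = V.

Definition simple_module M : Prop := simple_factor [set 0 : M] setT.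

Definition simple_submodule M : set (set M) :=
  [set U | submodule U /\ simple_factor [set 0] U].
Arguments simple_submodule : clear implicits.

Definition maximal_submodule M : set (set M) :=
  [set U | submodule U /\ simple_factor U setT].
Arguments maximal_submodule : clear implicits.

Definition socle M : set M :=
  smallest (@submodule M) (\bigcup_(U in simple_submodule M) U).
Arguments socle : clear implicits.

Definition radical M : set M := \bigcap_(U in maximal_submodule M) U.
Arguments radical : clear implicits.

Definition is_soc M T : Prop :=
  exists2 i : {linear T -> M}, injective_map i & range i = socle M.

Definition is_top M T : Prop :=
  exists2 p : {linear M -> T}, surjective_map p & kernel p = radical M.

Definition indecomposable M : Prop :=
  [set 0 : M] <> setT /\
  forall U V : set M, submodule U -> submodule V ->
    sum_set U V = setT -> U `&` V = [set 0] -> U = [set 0] \/ V = [set 0].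

(* [:: M_0; ...; M_l] with M_0 = 0, M_l = M and M_(i+1)/M_i simple; the default
   value set0 is not a submodule, so the sequence cannot be empty *)
Definition composition_series M (s : seq (set M)) : Prop :=
  [/\ forall i, (i < size s)%N -> submodule (nth set0 s i),
      head set0 s = [set 0], last set0 s = setT
    & forall i, (i.+1 < size s)%N ->
        simple_factor (nth set0 s i) (nth set0 s i.+1)].

Definition serial M : Prop := exists! s : seq (set M), composition_series s.

Definition projective P : Prop :=
  forall X Y (g : {linear X -> Y}) (f : {linear P -> Y}),
    surjective_map g -> exists h : {linear P -> X}, g \o h =1 f.

Definition injective_module Q : Prop :=
  forall X Y (g : {linear X -> Y}) (f : {linear X -> Q}),
    injective_map g -> exists h : {linear Y -> Q}, h \o g =1 f.

Definition superfluous M (U : set M) : Prop :=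
  forall V : set M, submodule V -> sum_set U V = setT -> V = setT.

Definition essential M (U : set M) : Prop :=
  forall V : set M, submodule V -> U `&` V = [set 0] -> V = [set 0].

Definition projective_cover P M (p : {linear P -> M}) : Prop :=
  [/\ projective P, surjective_map p & superfluous (kernel p)].

Definition injective_envelope M Q (i : {linear M -> Q}) : Prop :=
  [/\ injective_module Q, injective_map i & essential (range i)].

Definition is_PC M P : Prop := exists p : {linear P -> M}, projective_cover p.

Definition is_IE M Q : Prop := exists i : {linear M -> Q}, injective_envelope i.

(* M has a projective resolution 0 -> P_n -> ... -> P_1 -> P_0 -> M -> 0 *)
Definition proj_resolution_of_length M (n : nat) : Prop :=
  exists (P : nat -> lmodType A) (d : forall i, {linear P i.+1 -> P i})
         (eps : {linear P 0%N -> M}),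
    [/\ forall i, projective (P i),
        forall i, (n < i)%N -> [set 0 : P i] = setT,
        surjective_map eps,
        range (d 0%N) = kernel eps
      & forall i, range (d i.+1) = kernel (d i)].

Definition pd M : \bar int :=
  match pselect (exists n, `[< proj_resolution_of_length M n >]) with
  | left ex_n => ((ex_minn ex_n)%:Z)%:E
  | right _ => +oo%E
  end.

Definition rel_comp (R R' : lmodType A -> lmodType A -> Prop) X Y : Prop :=
  exists2 Z, R X Z & R' Z Y.

Fixpoint rel_iter (n : nat) (R : lmodType A -> lmodType A -> Prop) X Y : Prop :=
  if n is m.+1 then rel_comp (rel_iter m R) R X Y else isomorphic X Y.

Definition is_syzygy M K : Prop :=
  exists (P : lmodType A) (p : {linear P -> M}) (i : {linear K -> P}),
    [/\ projective_cover p, injective_map i & range i = kernel p].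

(* The module described by E (unique up to isomorphism) exists, so does the
   one described by E', and they are isomorphic. *)
Definition same_module (E E' : lmodType A -> Prop) : Prop :=
  [/\ exists X, E X, exists Y, E' Y
    & forall X Y, E X -> E' Y -> isomorphic X Y].

End Modules.

(* The right module Hom_A(P, A): (f a)(x) = f(x) a.  Scaling in P -> (A^c)^o is
   pointwise left multiplication in A^c, that is, right multiplication in A. *)
Section RegularDual.
Context {A : nzRingType}.
Implicit Types P Q : lmodType A.

Definition is_form P : {pred P -> (A^c)^o} :=
  fun f => `[< linear (f : P -> A^o) >].
Arguments is_form : clear implicits.

Lemma is_form_submod_closed P : submod_closed (is_form P).
Proof.
split.
  by apply/asboolP => a x y /=; rewrite scaler0 addr0.
move=> a f g /asboolP lf /asboolP lg; apply/asboolP => b x y.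
change ((f (b *: x + y) : A) * a + (g (b *: x + y) : A) =
  b * ((f x : A) * a + (g x : A)) + ((f y : A) * a + (g y : A))).
have -> : f (b *: x + y) = b * (f x : A) + (f y : A) :> A by exact: lf.
have -> : g (b *: x + y) = b * (g x : A) + (g y : A) :> A by exact: lg.
by rewrite mulrDl mulrDr mulrA !addrA; congr (_ + _); rewrite addrAC.
Qed.

HB.instance Definition _ P := GRing.isSubmodClosed.Build
  A^c (P -> (A^c)^o) (is_form P) (is_form_submod_closed P).

Record star P := Star { star_fun :> P -> (A^c)^o ; _ : star_fun \in is_form P }.

HB.instance Definition _ P := [isSub for @star_fun P].
HB.instance Definition _ P := [Choice of star P by <:].
HB.instance Definition _ P := [SubChoice_isSubLmodule of star P by <:].

Lemma star_map_subproof P Q (d : {linear P -> Q}) (f : star Q) :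
  star_fun f \o d \in is_form P.
Proof.
case: f => f /= /asboolP lf; apply/asboolP => a x y /=.
by rewrite linearP lf.
Qed.

Definition star_map P Q (d : {linear P -> Q}) (f : star Q) : star P :=
  Star (star_map_subproof d f).

(* X = Tr M, the cokernel of Hom_A(P0, A) -> Hom_A(P1, A) for a minimal
   projective presentation P1 -> P0 -> M -> 0, whose first map is the composite
   of a projective cover c of ker p0 with the inclusion i. *)
Definition is_Tr (M : lmodType A) (X : lmodType A^c) : Prop :=
  exists (P0 K P1 : lmodType A) (p : {linear P0 -> M}) (i : {linear K -> P0})
         (c : {linear P1 -> K}) (q : {linear star P1 -> X}),
    [/\ projective_cover p,
        injective_map i /\ range i = kernel p,
        projective_cover c
      & surjective_map q /\ kernel q = range (star_map (i \o c))].

End RegularDual.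

(* a seen as an element of A^c: [conv a *: x] is x a for x in a right module *)
Definition conv {A : nzRingType} (a : A) : A^c := a.

Section ArtinAlgebras.
Context {k : comNzRingType} {A : algType k}.

Definition artin_algebra : Prop :=
  artinian_module (k^o : lmodType k) /\ fin_gen (A : lmodType k).

(* The left module Hom_k(X, J) for a right module X: (a f)(x) = f(x a).  The
   scalar c : k acts on X as c%:A. *)
Section Duality.
Context (X : lmodType A^c) (J : lmodType k).

Definition k_linear : {pred X -> J} := fun f =>
  `[< {morph f : x y / x + y} /\
      forall (c : k) (x : X), f (conv (c%:A : A) *: x) = c *: f x >].

Lemma k_linear_zmod_closed : zmod_closed k_linear.
Proof.
split.
  by apply/asboolP; split=> [x y|c x] /=; rewrite ?addr0 ?scaler0.
move=> f g /asboolP[fD fZ] /asboolP[gD gZ]; apply/asboolP; split=> [x y|c x].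
  change (f (x + y) - g (x + y) = f x - g x + (f y - g y)).
  by rewrite fD gD opprD addrACA.
change (f (conv (c%:A : A) *: x) - g (conv c%:A *: x) = c *: (f x - g x)).
by rewrite fZ gZ scalerBr.
Qed.

HB.instance Definition _ := GRing.isZmodClosed.Build
  (X -> J) k_linear k_linear_zmod_closed.

Record kdual := KDual { kdual_fun :> X -> J ; _ : kdual_fun \in k_linear }.

HB.instance Definition _ := [isSub for kdual_fun].
HB.instance Definition _ := [Choice of kdual by <:].
HB.instance Definition _ := [SubChoice_isSubZmodule of kdual by <:].

Lemma kdual_scale_subproof (a : A) (f : kdual) :
  (fun x => f (conv a *: x)) \in k_linear.
Proof.
case: f => f /= /asboolP[fD fZ]; apply/asboolP; split=> [x y|c x] /=.
  by rewrite scalerDr fD.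
rewrite -fZ !scalerA; congr (f (_ *: _)).
change ((c%:A : A) * a = a * c%:A).
by rewrite -scalerAl -scalerAr mul1r mulr1.
Qed.

Definition kdual_scale (a : A) (f : kdual) : kdual :=
  KDual (kdual_scale_subproof a f).

Lemma kdual_scaleA a b f :
  kdual_scale a (kdual_scale b f) = kdual_scale (a * b) f.
Proof.
apply: val_inj; apply/funext => x /=; rewrite scalerA.
by [].
Qed.

Lemma kdual_scale1 : left_id 1 kdual_scale.
Proof.
by move=> f; apply: val_inj; apply/funext => x /=; rewrite (scale1r x).
Qed.

Lemma kdual_scaleDr : right_distributive kdual_scale +%R.
Proof. by move=> a f g; apply: val_inj. Qed.

Lemma kdual_scaleDl f : {morph kdual_scale^~ f : a b / a + b}.
Proof.
move=> a b; apply: val_inj; apply/funext => x /=.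
case: f => f /= /asboolP[fD _].
by rewrite scalerDl fD.
Qed.

HB.instance Definition _ := GRing.Zmodule_isLmodule.Build A kdual
  kdual_scaleA kdual_scale1 kdual_scaleDr kdual_scaleDl.

End Duality.

(* N = D X = Hom_k(X, J), with J an injective envelope of k / rad k *)
Definition is_D (X : lmodType A^c) (N : lmodType A) : Prop :=
  exists T J : lmodType k,
    [/\ is_top (k^o : lmodType k) T, is_IE T J
      & isomorphic (kdual X J : lmodType A) N].

Implicit Types M S T : lmodType A.

(* tau is applied to indecomposable non-projective modules only *)
Definition is_tau M T : Prop :=
  [/\ indecomposable M, ~ projective M
    & exists2 X : lmodType A^c, is_Tr M X & is_D X T].

(* e(S) = n *)
Definition is_e S (n : nat) : Prop :=
  exists2 Q, is_IE S Q & Order.min (pd S) (pd Q) = (n%:Z)%:E.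

(* N S for e(S) = n *)
Definition is_N (n : nat) S M : Prop :=
  if odd n then isomorphic S M else is_IE S M.

Definition is_h S T : Prop :=
  exists2 n, is_e S n & rel_comp (is_N n) (rel_comp (rel_iter n is_syzygy) is_top) S T.

Definition is_phi S T : Prop := simple_module S /\ rel_comp is_IE is_top S T.

(* defined only if the socle of the projective cover is not projective, which
   is part of [is_tau] *)
Definition is_gamma S T : Prop :=
  simple_module S /\ rel_comp is_PC (rel_comp is_soc is_tau) S T.

End ArtinAlgebras.
Arguments artin_algebra {k} A.

Definition nakayama_algebra (k : comNzRingType) (A : algType k) : Prop :=
  artin_algebra A /\
  forall M : lmodType A, fin_gen M -> indecomposable M -> serial M.

(* Main.v *)
Require Import Defs.
From HB Require Import structures.
From mathcomp Require Import all_boot all_order all_algebra.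
From mathcomp Require Import boolp classical_sets functions constructive_ereal.

(** Write Omega M for the syzygy of M.  Over a Nakayama algebra a finitely
    generated indecomposable module is uniserial: its submodules form a finite
    chain.  The same holds for its projective cover, its syzygies and all their
    quotients.  The theorem is the identity top (Omega^2 M) = gamma (top M) for
    such an M, iterated.  It is obtained from three facts.

    - If Omega M <> 0 and P covers M, then P also covers top M, and Omega M is
      a nonzero submodule of the uniserial module P; hence Omega M and
      P (top M) have the same socle (socle_syzygy).
    - Lifting soc M -> M to projective covers maps Omega (soc M) onto Omega M,
      because two submodules of P are comparable; hence Omega (soc M) and
      Omega M have the same top (top_syzygy_socle).
    - For a simple non-projective Z one has tau Z = top (Omega Z) (tau_top).

    The second fact for Omega M, the third for Z = soc (Omega M) and the first
    for M give top (Omega^2 M) = tau (soc P (top M)) (gamma_top).  For e(S) = 2t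
    start from M = IS, whose top is phi(S); for e(S) = 2t + 1 start from Omega S,
    whose top is tau S.  The syzygies met on the way are not zero because e(S) is
    at most pd IS and pd S (syzygy_nontrivial).

    The formula for tau Z is where the definition D Tr is unfolded.  Let
    P1 -> P0 -> Z -> 0 be a minimal presentation, with a : P1 -> P0.  A map g
    from P1 to a uniserial module Q that is not onto factors through a
    (factor_through): the pushout of P0 <- P1 -> Q / rad (im g) has incomparable
    submodules, so it is decomposable, and a summand that avoids the image of P1
    is the graph of a map P0 -> Q which corrects g to a map of smaller image.
    Consequently a form P1 -> A either factors through a or embeds P1 as a
    summand, and Tr Z, the cokernel of a^*, is a simple right module
    (transpose_simple).  Over the residue field of k at its annihilator, D
    becomes the usual vector space duality, so D Tr Z is simple (kdual_simple);
    an idempotent of A that generates a copy of P1 does not kill it, so its top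
    is that of P1, which is the top of Omega Z (DTr_top).

    Two existence results support this.  D is defined by an injective envelope
    over k, which is found as a maximal essential extension inside the
    coinduced module of a power of Q/Z (IE_exists).  And the given envelope IS
    is uniserial: its finitely generated submodules have simple socle, hence
    are uniserial, and their length is bounded by that of A (IE_uniserial). *)

Set Implicit Arguments.
Unset Strict Implicit.
Unset Printing Implicit Defensive.

Import Order.TTheory GRing.Theory Num.Theory.
Local Open Scope classical_set_scope.
Local Open Scope ring_scope.

Local Arguments socle {A} M _.
Local Arguments radical {A} M _.
Local Arguments simple_submodule {A} M _.
Local Arguments maximal_submodule {A} M _.

(** * Extremal elements and Zorn's lemma *)

Lemma subsetT_eq (T : Type) (U : set T) : setT `<=` U -> U = setT.
Proof. by move=> UT; apply/seteqP; split. Qed.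

Lemma not_subset (T : Type) (U V : set T) :
  ~ U `<=` V -> exists2 x, U x & ~ V x.
Proof.
move=> UV; apply/not_exists2P => /= nx; apply: UV => x Ux.
by have [|/contrapT] := nx x.
Qed.

Lemma ex_argmax (T : Type) (P : T -> Prop) (f : T -> nat) (L : nat) :
  (exists x, P x) -> (forall x, P x -> f x <= L)%N ->
  exists x, P x /\ forall y, P y -> (f y <= f x)%N.
Proof.
move=> [x0 Px0] fL.
have exP : exists n, `[< exists x, P x /\ f x = n >].
  by exists (f x0); apply/asboolP; exists x0.
have bP n : `[< exists x, P x /\ f x = n >] -> (n <= L)%N.
  by move=> /asboolP[x [Px <-]]; exact: fL.
case: (ex_maxnP exP bP) => n /asboolP[x [Px fx]] maxn.
exists x; split=> // y Py; rewrite fx; apply: maxn.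
by apply/asboolP; exists y.
Qed.

Lemma ex_argmin (T : Type) (P : T -> Prop) (f : T -> nat) :
  (exists x, P x) -> exists x, P x /\ forall y, P y -> (f x <= f y)%N.
Proof.
move=> [x0 Px0].
have exP : exists n, `[< exists x, P x /\ f x = n >].
  by exists (f x0); apply/asboolP; exists x0.
case: (ex_minnP exP) => n /asboolP[x [Px fx]] minn.
exists x; split=> // y Py; rewrite fx; apply: minn.
by apply/asboolP; exists y.
Qed.

(** Zorn's lemma with the chain condition asked of nonempty chains only, which
    is what a union of submodules satisfies. *)
Lemma Zorn_nonempty (T : Type) (P : set (set T)) (A0 : set T) : P A0 ->
  (forall F : set (set T), F !=set0 -> F `<=` P -> total_on F subset ->
     P (\bigcup_(A in F) A)) ->
  exists A, P A /\ forall B, P B -> A `<=` B -> B = A.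
Proof.
move=> PA0 cP.
have [F FP Ftot|A [PA Amax]] := @Zorn_bigcup T [set A | P A \/ A = set0].
  pose F' := F `&` P.
  have FF' : \bigcup_(A in F) A = \bigcup_(A in F') A.
    apply/seteqP; split=> x [A FA Ax]; exists A => //; last by case: FA.
    by split=> //; have [//|A0'] := FP _ FA; rewrite A0' in Ax.
  have [F'0|F'0] := pselect (F' !=set0); last first.
    right; rewrite FF'; apply/seteqP; split=> // x [A F'A _].
    by case: F'0; exists A.
  left; rewrite /= FF'; apply: cP => //; first by move=> A [].
  by move=> A B [FA _] [FB _]; exact: Ftot.
have {}PA : P A.
  case: PA => // A0'; subst A.
  have [->//|ne] := pselect (set0 = A0); case: (Amax A0); last by left.
  by split=> // h; apply: ne; apply/seteqP; split.
exists A; split=> // B PB AB; apply: contrapT => BA.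
by case: (Amax B); [split=> // h; apply: BA; apply/seteqP|left].
Qed.

Lemma chain_bigcup_pair (T : Type) (F : set (set T)) (x y : T) :
  total_on F subset -> (\bigcup_(A in F) A) x -> (\bigcup_(A in F) A) y ->
  exists A, [/\ F A, A x & A y].
Proof.
move=> tF [A FA Ax] [B FB By]; have [AB|BA] := tF _ _ FA FB.
  by exists B; split=> //; exact: AB.
by exists A; split=> //; exact: BA.
Qed.

(** * Linear maps, submodules and quotients *)

Section LinearMaps.
Context {R : nzRingType}.
Implicit Types M N K Q X : lmodType R.

Definition lin M N (f : M -> N) (lf : linear f) : {linear M -> N} :=
  HB.pack f (GRing.isLinear.Build R M N *:%R f lf).

Lemma linZ M N (f : {linear M -> N}) c x : f (c *: x) = c *: f x.
Proof. exact: linearZ. Qed.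

Lemma surjectiveP M N (f : {linear M -> N}) :
  surjective_map f <-> forall y, exists x, f x = y.
Proof.
split=> [sf y|sf]; last first.
  by apply/seteqP; split=> // y _; have [x <-] := sf y; exists x.
have : setT y by [].
by rewrite -sf => -[x _ <-]; exists x.
Qed.

Lemma injectiveP M N (f : {linear M -> N}) :
  injective_map f <-> forall x, f x = 0 -> x = 0.
Proof.
split=> [fI x fx0|f0 x y fxy]; first by apply: fI; rewrite fx0 linear0.
by apply/subr0_eq/f0; rewrite linearB fxy subrr.
Qed.

(** With [lift_surj], this lets submodules and quotients be handled as arbitrary
    injections and surjections instead of concrete carriers. *)
Lemma lift_inj K M N (i : {linear K -> M}) (f : {linear N -> M}) :
  injective_map i -> (forall x, range i (f x)) ->
  exists h : {linear N -> K}, forall x, i (h x) = f x.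
Proof.
move=> iI fi.
have h_ex x : exists y, i y = f x by have [y _ <-] := fi x; exists y.
pose h x := projT1 (cid (h_ex x)).
have hE x : i (h x) = f x by rewrite /h; case: cid.
have lh : linear h by move=> a x y; apply: iI; rewrite linearP !hE linearP.
by exists (lin lh).
Qed.

Lemma lift_surj M N Q (q : {linear M -> Q}) (f : {linear M -> N}) :
  surjective_map q -> (forall x, q x = 0 -> f x = 0) ->
  exists h : {linear Q -> N}, forall x, h (q x) = f x.
Proof.
move=> /surjectiveP qS qf.
pose h y := f (projT1 (cid (qS y))).
have hE x : h (q x) = f x.
  rewrite /h; case: cid => z /= zx; apply/subr0_eq.
  by rewrite -linearB qf // linearB zx subrr.
have lh : linear h.
  move=> a x y; have [x' <-] := qS x; have [y' <-] := qS y.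
  by rewrite -linearP !hE linearP.
by exists (lin lh).
Qed.

Lemma isomorphicP M N :
  isomorphic M N <->
  exists f : {linear M -> N}, injective_map f /\ surjective_map f.
Proof.
split=> [[f fb]|[f [fI /surjectiveP fS]]]; exists f.
  split; first exact: bij_inj.
  by apply/surjectiveP => y; have [g _ gK] := fb; exists (g y).
pose g y := projT1 (cid (fS y)).
have gK : cancel g f by move=> y; rewrite /g; case: cid.
by exists g => // x; apply: fI; rewrite gK.
Qed.

Lemma iso_refl M : isomorphic M M.
Proof. by exists idfun; exists idfun. Qed.

Lemma iso_sym M N : isomorphic M N -> isomorphic N M.
Proof.
move=> /isomorphicP[f [fI /surjectiveP fS]].
have fT y : range f (idfun y : N) by have [x <-] := fS y; exists x.
have [g gE] := lift_inj fI fT.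
apply/isomorphicP; exists g; split.
  by apply/injectiveP => x gx0; rewrite -[x]/(idfun x) -gE gx0 linear0.
by apply/surjectiveP => x; exists (f x); apply: fI; rewrite gE.
Qed.

Lemma iso_trans M N K : isomorphic M N -> isomorphic N K -> isomorphic M K.
Proof. by move=> [f fb] [g gb]; exists (g \o f); exact: bij_comp. Qed.

Lemma surjective_comp M N K (f : {linear M -> N}) (g : {linear N -> K}) :
  surjective_map f -> surjective_map g -> surjective_map (g \o f).
Proof.
move=> /surjectiveP fS /surjectiveP gS; apply/surjectiveP => z.
by have [y <-] := gS z; have [x <-] := fS y; exists x.
Qed.

Lemma injective_comp M N K (f : {linear M -> N}) (g : {linear N -> K}) :
  injective_map f -> injective_map g -> injective_map (g \o f).
Proof. by move=> fI gI; apply: inj_comp. Qed.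

End LinearMaps.

Section Submodules.
Context {R : nzRingType}.
Implicit Types M N K Q X : lmodType R.

Lemma submoduleP M (U : set M) :
  submodule U <-> U 0 /\ forall a u v, U u -> U v -> U (a *: u + v).
Proof.
rewrite /submodule; split=> -[U0 UP]; split.
- by move: U0; rewrite inE.
- by move=> a u v Uu Uv; have := UP a u v; rewrite !inE; apply.
- by rewrite inE.
- by move=> a u v; rewrite !inE; exact: UP.
Qed.

Section Closure.
Context M (U : set M) (hU : submodule U).

Lemma sub0 : U 0. Proof. by case/submoduleP: hU. Qed.
Lemma subZ a u : U u -> U (a *: u).
Proof. by case/submoduleP: hU => U0 UP Uu; rewrite -[_ *: _]addr0; exact: UP. Qed.
Lemma subD u v : U u -> U v -> U (u + v).
Proof.
by case/submoduleP: hU => U0 UP Uu Uv; rewrite -[u]scale1r; exact: UP.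
Qed.
Lemma subN u : U u -> U (- u).
Proof. by move=> Uu; rewrite -scaleN1r; exact: subZ. Qed.
Lemma subB u v : U u -> U v -> U (u - v).
Proof. by move=> Uu Uv; apply: subD => //; exact: subN. Qed.
Lemma subDr u v : U v -> U (u + v) -> U u.
Proof. by move=> Uu Uuv; rewrite -[u](addrK v); exact: subB. Qed.

End Closure.

Lemma submodule0 M : submodule [set 0 : M].
Proof.
by apply/submoduleP; split=> // a u v -> ->; rewrite scaler0 addr0.
Qed.

Lemma submoduleT M : submodule [set: M].
Proof. exact/submoduleP. Qed.

Lemma submoduleI M (U V : set M) :
  submodule U -> submodule V -> submodule (U `&` V).
Proof.
move=> hU hV; apply/submoduleP; split=> [|a u v [Uu Vu] [Uv Vv]].
  by split; exact: sub0.
by split; apply: subD => //; exact: subZ.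
Qed.

Lemma submodule_bigcap M (F : set (set M)) :
  (forall U, F U -> submodule U) -> submodule (\bigcap_(U in F) U).
Proof.
move=> hF; apply/submoduleP; split=> [U FU|a u v uF vF U FU].
  exact: sub0 (hF _ FU).
have hU := hF _ FU.
by apply: subD => //; [apply: subZ => //; exact: uF|exact: vF].
Qed.

Lemma submodule_sum M (U V : set M) :
  submodule U -> submodule V -> submodule (sum_set U V).
Proof.
move=> hU hV; apply/submoduleP; split.
  by exists 0; [exact: sub0|exists 0; [exact: sub0|rewrite addr0]].
move=> a _ _ [u Uu [v Vv <-]] [u' Uu' [v' Vv' <-]].
exists (a *: u + u'); first by apply: subD => //; exact: subZ.
exists (a *: v + v'); first by apply: subD => //; exact: subZ.
by rewrite scalerDr addrACA.
Qed.

Lemma sum_setl M (U V : set M) : submodule V -> U `<=` sum_set U V.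
Proof.
by move=> hV u Uu; exists u => //; exists 0; [exact: sub0|rewrite addr0].
Qed.

Lemma sum_setr M (U V : set M) : submodule U -> V `<=` sum_set U V.
Proof.
by move=> hU u Uu; exists 0; [exact: sub0|exists u; rewrite ?add0r].
Qed.

Lemma sum_setC M (U V : set M) : sum_set U V = sum_set V U.
Proof.
by apply/seteqP; split=> _ [u Uu [v Vv <-]]; exists v => //; exists u;
   rewrite // addrC.
Qed.

Lemma submodule_preim M N (f : {linear M -> N}) (V : set N) :
  submodule V -> submodule (f @^-1` V).
Proof.
move=> hV; apply/submoduleP; split=> [|a u v Vu Vv] /=.
  by rewrite linear0; exact: sub0.
by rewrite linearP; apply: subD => //; exact: subZ.
Qed.

Lemma submodule_image M N (f : {linear M -> N}) (U : set M) :
  submodule U -> submodule (f @` U).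
Proof.
move=> hU; apply/submoduleP; split.
  by exists 0; rewrite ?linear0//; exact: sub0.
move=> a _ _ [u Uu <-] [v Uv <-]; exists (a *: u + v); last exact: linearP.
by apply: subD => //; exact: subZ.
Qed.

Lemma submodule_ker M N (f : {linear M -> N}) : submodule (kernel f).
Proof. exact/submodule_preim/submodule0. Qed.

Lemma submodule_range M N (f : {linear M -> N}) : submodule (range f).
Proof. exact/submodule_image/submoduleT. Qed.

Lemma submodule_socle M : submodule (socle M).
Proof. by apply: submodule_bigcap => U []. Qed.

Lemma submodule_radical M : submodule (radical M).
Proof. by apply: submodule_bigcap => U []. Qed.

Definition cyc M (x : M) : set M := range (fun a : R => a *: x).

Lemma submodule_cyc M (x : M) : submodule (cyc x).
Proof.
apply/submoduleP; split; first by exists 0; rewrite ?scale0r.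
move=> a _ _ [b _ <-] [c _ <-]; exists (a * b + c) => //.
by rewrite scalerDl scalerA.
Qed.

Lemma cyc_id M (x : M) : cyc x x.
Proof. by exists 1; rewrite ?scale1r. Qed.

Lemma cyc_sub M (U : set M) x : submodule U -> U x -> cyc x `<=` U.
Proof. by move=> hU Ux _ [a _ <-]; exact: subZ. Qed.

Lemma zero_neq M (U : set M) :
  submodule U -> U <> [set 0] -> exists2 x, U x & x <> 0.
Proof.
move=> hU U0; apply/not_exists2P => /= nx; apply: U0.
apply/seteqP; split=> [x Ux|_ ->]; last exact: sub0.
by have [|/contrapT] := nx x.
Qed.

Section SubmoduleType.
Context M (U : set M) (hU : submodule U).

Definition submodule_pred (h : submodule U) : {pred M} := [in U].

HB.instance Definition _ :=
  GRing.isSubmodClosed.Build R M (submodule_pred hU)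
  (hU : submod_closed (submodule_pred hU)).

Record subm := Subm { subm_val :> M; _ : subm_val \in submodule_pred hU }.

HB.instance Definition _ := [isSub for subm_val].
HB.instance Definition _ := [Choice of subm by <:].
HB.instance Definition _ := [SubChoice_isSubLmodule of subm by <:].

End SubmoduleType.

(** Every submodule is the image of an injection; together with
    [quotient_module] this hides the two concrete constructions. *)
Lemma submodule_module M (U : set M) : submodule U ->
  exists (K : lmodType R) (i : {linear K -> M}),
    injective_map i /\ range i = U.
Proof.
move=> hU; exists (subm hU).
have lv : linear (val : subm hU -> M) by move=> a x y.
exists (lin lv); split; first exact: val_inj.
apply/seteqP; split=> [_ [x _ <-]|x Ux] /=.
  by case: x => x /=; rewrite inE.
have Ux' : x \in submodule_pred hU by rewrite inE.
by exists (Subm Ux').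
Qed.

Section QuotientType.
Context M (U : set M) (hU : submodule U).

Definition quotm_pred (h : submodule U) : {pred M} := [in U].

HB.instance Definition _ :=
  GRing.isSubmodClosed.Build R M (quotm_pred hU)
  (hU : submod_closed (quotm_pred hU)).

Definition quotm := Quotient.quot (quotm_pred hU).

HB.instance Definition _ := GRing.Zmodule.on quotm.


Local Open Scope quotient_scope.

Lemma quot_eqP (x y : M) : \pi_quotm x = \pi_quotm y <-> U (x - y).
Proof.
split=> [/eqP|h]; first by rewrite -Quotient.idealrBE inE.
by apply/eqP; rewrite -Quotient.idealrBE inE.
Qed.

Definition quot_scale (a : R) (x : quotm) : quotm := \pi_quotm (a *: repr x).

Lemma pi_scale a x : \pi_quotm (a *: x) = quot_scale a (\pi_quotm x).
Proof.
apply/quot_eqP; rewrite -scalerBr; apply: subZ => //.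
by apply/quot_eqP; rewrite reprK.
Qed.

Lemma quot_scaleA a b x : quot_scale a (quot_scale b x) = quot_scale (a * b) x.
Proof. by rewrite -[x]reprK -(pi_scale b) -!pi_scale scalerA. Qed.

Lemma quot_scale1 : left_id 1 quot_scale.
Proof. by move=> x; rewrite -[x]reprK -!pi_scale scale1r. Qed.

Lemma quot_scaleDr : right_distributive quot_scale +%R.
Proof.
by move=> a x y; rewrite -[x]reprK -[y]reprK -raddfD -!pi_scale scalerDr raddfD.
Qed.

Lemma quot_scaleDl x : {morph quot_scale^~ x : a b / a + b}.
Proof.
by move=> a b; rewrite -[x]reprK -!pi_scale scalerDl raddfD.
Qed.

HB.instance Definition _ := GRing.Zmodule_isLmodule.Build R quotm
  quot_scaleA quot_scale1 quot_scaleDr quot_scaleDl.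

End QuotientType.

Lemma quotient_module M (U : set M) : submodule U ->
  exists (Q : lmodType R) (q : {linear M -> Q}),
    surjective_map q /\ kernel q = U.
Proof.
move=> hU; exists (quotm hU : lmodType R).
have lpi : linear (\pi_(quotm hU)%qT : M -> quotm hU).
  by move=> a x y; rewrite raddfD; congr (_ + _); exact: pi_scale.
exists (lin lpi); split.
  by apply/surjectiveP => y; exists (repr y); exact: reprK.
have p0 : (\pi_(quotm hU) 0)%qT = 0 by exact: raddf0.
apply/seteqP; split=> x.
  change ((\pi_(quotm hU) x)%qT = 0 -> U x).
  by rewrite -p0 => /quot_eqP; rewrite subr0.
change (U x -> (\pi_(quotm hU) x)%qT = 0).
by move=> Ux; rewrite -p0; apply/quot_eqP; rewrite subr0.
Qed.

End Submodules.

(** * Uniserial modules, their tops and socles *)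

Section Uniserial.
Context {R : nzRingType}.
Implicit Types M N K Q P X S T Z : lmodType R.

Definition nontrivial M := exists x : M, x <> 0.

Definition chain_module M := forall U V : set M,
  submodule U -> submodule V -> U `<=` V \/ V `<=` U.

(** A bounded strictly increasing function on the submodules of Z stands for the
    length of Z: it is inherited by submodules and quotients. *)
Definition ranked M (Z : set M) (L : nat) := exists r : set M -> nat,
  (forall U V, submodule U -> submodule V -> U `<` V -> V `<=` Z ->
     (r U < r V)%N) /\
  (forall V, submodule V -> V `<=` Z -> (r V <= L)%N).

Definition uniserial M := chain_module M /\ exists L, ranked [set: M] L.

(** m is the largest proper submodule, a property expressed on elements. *)
Definition local_at M (m : set M) :=
  [/\ submodule m, m <> setT & forall v, ~ m v -> cyc v = setT].

Lemma nontrivialP M : nontrivial M <-> [set 0 : M] <> setT.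
Proof.
split=> [[x x0] e|ne].
  by apply: x0; have : [set: M] x by []; rewrite -e.
have := @zero_neq R M setT (submoduleT _).
by case=> [e|x _ x0]; [apply: ne|exists x].
Qed.

Lemma trivialP M : ~ nontrivial M -> forall x : M, x = 0.
Proof. by move=> nt x; apply/not_notP => x0; apply: nt; exists x. Qed.

Lemma ranked_sub M (Z Z' : set M) L L' :
  Z' `<=` Z -> (L <= L')%N -> ranked Z L -> ranked Z' L'.
Proof.
move=> ZZ LL [r [r1 r2]]; exists r; split.
  by move=> U V hU hV UV VZ; apply: r1 => //; exact: subset_trans ZZ.
move=> V hV VZ; apply: leq_trans LL; apply: r2 => //; exact: subset_trans ZZ.
Qed.

Lemma ranked_inj M N (f : {linear N -> M}) L :
  injective_map f -> ranked (range f) L -> ranked [set: N] L.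
Proof.
move=> fI [r [r1 r2]]; exists (fun U => r (f @` U)).
have imR (V : set N) : f @` V `<=` range f by move=> _ [x _ <-]; exists x.
split=> [U V hU hV [UV VU] _|V hV _].
  apply: r1 => //; try exact: submodule_image.
  split=> [|VU']; first exact: image_subset.
  by apply: VU => v Vv; have [|u Uu /fI <-] := VU' (f v); first exists v.
by apply: r2 => //; exact: submodule_image.
Qed.

Lemma ranked_surj M N (f : {linear M -> N}) L (U : set M) :
  submodule U -> ranked U L -> ranked (f @` U) L.
Proof.
move=> hU [r [r1 r2]]; exists (fun V => r (f @^-1` V `&` U)).
split=> [V W hV hW [VW WV] WU|V hV _]; last first.
  apply: r2; last by move=> x [].
  by apply: submoduleI => //; exact: submodule_preim.
apply: r1; try by [|move=> x []].
- by apply: submoduleI => //; exact: submodule_preim.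
- by apply: submoduleI => //; exact: submodule_preim.
split=> [x [/= Vx Ux]|WV']; first by split=> //=; exact: VW.
apply: WV => w Ww; have [u Uu uw] := WU _ Ww; subst w.
by have [] := WV' u.
Qed.

Lemma uniserial_inj M N (f : {linear N -> M}) :
  injective_map f -> uniserial M -> uniserial N.
Proof.
move=> fI [cM [L rM]]; split.
  have imS (U V : set N) : f @` U `<=` f @` V -> U `<=` V.
    by move=> UV u Uu; have [|v Vv /fI <-] := UV (f u); first exists u.
  move=> U V hU hV.
  have [UV|VU] := cM _ _ (submodule_image f hU) (submodule_image f hV).
    by left; exact: imS.
  by right; exact: imS.
exists L; apply: (ranked_inj fI); exact: ranked_sub rM.
Qed.

Lemma uniserial_surj M N (f : {linear M -> N}) :
  surjective_map f -> uniserial M -> uniserial N.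
Proof.
move=> /[dup] fS /surjectiveP sf [cM [L rM]]; split.
  have imS (U V : set N) : f @^-1` U `<=` f @^-1` V -> U `<=` V.
    by move=> UV u Uu; have [x xu] := sf u; subst u; exact: UV.
  move=> U V hU hV.
  have [UV|VU] := cM _ _ (submodule_preim f hU) (submodule_preim f hV).
    by left; exact: imS.
  by right; exact: imS.
exists L; rewrite -fS; apply: ranked_surj => //; exact: submoduleT.
Qed.

Lemma uniserial_iso M N : isomorphic M N -> uniserial M -> uniserial N.
Proof. by move=> /isomorphicP[f [_ fS]]; exact: uniserial_surj fS. Qed.

Lemma uniserial_trivial M : ~ nontrivial M -> uniserial M.
Proof.
move=> M0; split.
  move=> U V hU hV; left=> x _; rewrite (trivialP M0 x); exact: sub0.
exists 0%N, (fun=> 0%N); split=> // U V hU hV [UV VU] _; exfalso.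
by apply: VU => x _; rewrite (trivialP M0 x); exact: sub0.
Qed.

Lemma nontrivial_inj M N (f : {linear M -> N}) :
  injective_map f -> nontrivial M -> nontrivial N.
Proof.
move=> /injectiveP fI [x x0]; exists (f x) => fx0; apply: x0; exact: fI.
Qed.

Lemma nontrivial_surj M N (f : {linear M -> N}) :
  surjective_map f -> nontrivial N -> nontrivial M.
Proof.
move=> /surjectiveP fS [y y0]; have [x xy] := fS y; exists x => x0.
by apply: y0; rewrite -xy x0 linear0.
Qed.

Lemma nontrivial_iso M N : isomorphic M N -> nontrivial M -> nontrivial N.
Proof. by move=> /isomorphicP[f [fI _]]; exact: nontrivial_inj fI. Qed.

(** A proper submodule of maximal rank contains all others, by comparability. *)
Lemma uniserial_local M : uniserial M -> nontrivial M ->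
  exists m : set M, local_at m.
Proof.
move=> [cM [L [r [r1 r2]]]] /nontrivialP M0.
have [||m [[hm mT] mmax]] := @ex_argmax _
    (fun m : set M => submodule m /\ m <> setT) r L.
- by exists [set 0]; split=> //; exact: submodule0.
- by move=> U [hU _]; exact: r2.
exists m; split=> // v mv; apply: contrapT => vT.
have hv := submodule_cyc v.
have mv' : m `<` cyc v.
  have [vm|mv'] := cM _ _ hv hm; first by case: mv; apply/vm/cyc_id.
  by split=> // vm; apply/mv/vm/cyc_id.
have := r1 _ _ hm hv mv' (@subsetT _ _); rewrite ltnNge => /negP; apply.
exact: mmax.
Qed.

Lemma local_sub M (m U : set M) :
  local_at m -> submodule U -> U <> setT -> U `<=` m.
Proof.
move=> [hm mT mv] hU UT u Uu; apply: contrapT => /mv uT; apply: UT.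
by apply: subsetT_eq; rewrite -uT; exact: cyc_sub.
Qed.

Lemma local_point M (m : set M) : local_at m -> exists v, ~ m v.
Proof.
move=> [hm mT _]; have /not_subset[v _ mv] : ~ setT `<=` m.
  by move=> /subsetT_eq.
by exists v.
Qed.

Lemma uniserial_cyclic M : uniserial M -> exists x : M, cyc x = setT.
Proof.
move=> uM; have [M0|M0] := pselect (nontrivial M); last first.
  exists 0; apply: subsetT_eq => x _; rewrite (trivialP M0 x).
  exact: sub0 (submodule_cyc _).
have [m hm] := uniserial_local uM M0.
by have [v mv] := local_point hm; exists v; case: hm => _ _; apply.
Qed.

Lemma cyclic_fin_gen M (x : M) : cyc x = setT -> fin_gen M.
Proof.
move=> xT; exists 1%N, (fun=> x) => y.
have : [set: M] y by [].
by rewrite -xT => -[a _ <-]; exists (fun=> a); rewrite big_ord1.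
Qed.

Lemma simpleP T : simple_module T <->
  nontrivial T /\ forall v : T, v <> 0 -> cyc v = setT.
Proof.
rewrite /simple_module /simple_factor; split.
  move=> [[_ T0] sT]; split.
    by apply/nontrivialP => e; apply: T0; rewrite e.
  move=> v v0; have [| | |e|//] := sT (cyc v); first exact: submodule_cyc.
  - by move=> _ ->; exact: sub0 (submodule_cyc _).
  - by [].
  - by case: v0; have := cyc_id v; rewrite e.
move=> [/nontrivialP T0 sT]; split.
  by split=> // /subsetT_eq.
move=> W hW _ _; have [W0|/(zero_neq hW)[w Ww w0]] := pselect (W = [set 0]).
  by left.
by right; apply: subsetT_eq; rewrite -(sT w w0); exact: cyc_sub.
Qed.

Lemma simple_nontrivial T : simple_module T -> nontrivial T.
Proof. by case/simpleP. Qed.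

Lemma simple_local T : simple_module T -> local_at [set 0 : T].
Proof.
by move=> /simpleP[/nontrivialP T0 sT]; split=> //; exact: submodule0.
Qed.

Lemma simple_submodules T (U : set T) :
  simple_module T -> submodule U -> U = [set 0] \/ U = setT.
Proof.
move=> sT hU; have [|UT] := pselect (U = setT); first by right.
left; apply/seteqP; split; first exact: local_sub (simple_local sT) hU UT.
by move=> _ ->; exact: sub0.
Qed.

Lemma simple_uniserial T : simple_module T -> uniserial T.
Proof.
move=> sT; split.
  move=> U V hU hV; have [-> |-> ] := simple_submodules sT hU; last by right.
  by left=> _ ->; exact: sub0.
exists 1%N, (fun U => `[< U = setT >] : nat); split; last by move=> *; exact: leq_b1.
move=> U V hU hV UV _.
have [V0|VT] := simple_submodules sT hV.
  by case: UV => _ []; rewrite V0 => _ ->; exact: sub0.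
have -> : `[< V = setT >] by apply/asboolP.
by case: asboolP => // UT; case: UV => _ []; rewrite UT.
Qed.

Lemma local_maximal M (m : set M) : local_at m -> maximal_submodule M m.
Proof.
move=> lm; have [hm mT _] := lm; split=> //; split.
  by split=> // /subsetT_eq.
move=> W hW mW _; have [|WT] := pselect (W = setT); first by right.
by left; apply/seteqP; split=> //; exact: local_sub.
Qed.

Lemma local_radical M (m : set M) : local_at m -> radical M = m.
Proof.
move=> lm; have [hm mT mv] := lm; apply/seteqP; split.
  by move=> x; apply; exact: local_maximal.
move=> x mx U [hU [[_ UT] Umax]].
have [|<- //|e] := Umax m hm _ (@subsetT _ _).
  by apply: local_sub => // e; apply: UT; rewrite e.
by case: mT.
Qed.

(** The radical of a local module is its largest proper submodule, so any
    surjection onto a simple module has that kernel. *)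
Lemma top_local M T (m : set M) : local_at m ->
  is_top M T <->
  simple_module T /\ exists q : {linear M -> T}, surjective_map q.
Proof.
move=> lm; have [hm mT mv] := lm; split.
  move=> [q /[dup] qS /surjectiveP sq]; rewrite (local_radical lm) => kq.
  split; last by exists q.
  apply/simpleP; split.
    have [v nmv] := local_point lm; exists (q v) => qv0; apply: nmv.
    by rewrite -kq.
  move=> w w0; have [v vw] := sq w; subst w.
  have /mv vT : ~ m v by rewrite -kq.
  apply: subsetT_eq => y _; have [x <-] := sq y.
  have : [set: M] x by [].
  by rewrite -vT => -[a _ <-]; exists a => //; rewrite linearZ.
move=> [/simpleP[T0 sT] [q /[dup] qS /surjectiveP sq]]; exists q => //.
rewrite (local_radical lm).
have km : kernel q `<=` m.
  apply: local_sub => //; first exact: submodule_ker.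
  have [y y0] := T0; have [x xy] := sq y; move=> kT; apply: y0.
  by rewrite -xy; have : [set: M] x by []; rewrite -kT.
apply/seteqP; split=> // x mx; apply: contrapT => qx0.
have [v] := local_point lm; apply.
have : [set: T] (q v) by [].
rewrite -(sT (q x) qx0) => -[a _ /= qv].
have : m (v - a *: x) by apply: km; rewrite /kernel /= linearB linearZ /= qv subrr.
exact: (subDr hm (subN hm (subZ hm a mx))).
Qed.

Lemma top_exists M : exists T, is_top M T.
Proof.
have [T [q [qS qk]]] := quotient_module (submodule_radical M).
by exists T, q.
Qed.

Lemma top_unique M T T' : is_top M T -> is_top M T' -> isomorphic T T'.
Proof.
move=> [q qS qk] [q' q'S q'k].
have [|h hE] := lift_surj (f := q') qS.
  by move=> x qx; change (kernel q' x); rewrite q'k -qk.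
apply/isomorphicP; exists h; split.
  apply/injectiveP => y; have [x <-] := (surjectiveP _).1 qS y.
  by rewrite hE => q'x; change (kernel q x); rewrite qk -q'k.
by apply/surjectiveP => y; have [x <-] := (surjectiveP _).1 q'S y; exists (q x).
Qed.

Lemma top_iso M T T' : isomorphic T T' -> is_top M T -> is_top M T'.
Proof.
move=> /isomorphicP[f [/injectiveP fI fS]] [q qS qk]; exists (f \o q).
  exact: surjective_comp.
rewrite -qk; apply/seteqP; split=> x; rewrite /kernel /=.
  by move=> /fI.
by move=> ->; rewrite linear0.
Qed.

Lemma top_uniserial M T : uniserial M -> nontrivial M ->
  is_top M T <->
  simple_module T /\ exists q : {linear M -> T}, surjective_map q.
Proof.
by move=> uM M0; have [m lm] := uniserial_local uM M0; exact: top_local lm.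
Qed.

(** A simple quotient of N is one of M, and a nonzero uniserial module has only
    one simple quotient. *)
Lemma top_surj M N T (f : {linear M -> N}) : uniserial M -> nontrivial N ->
  surjective_map f -> is_top N T <-> is_top M T.
Proof.
move=> uM N0 fS; have uN := uniserial_surj fS uM.
have M0 := nontrivial_surj fS N0.
have NM T' : is_top N T' -> is_top M T'.
  move=> /(top_uniserial _ uN N0)[sT [q qS]].
  apply/(top_uniserial _ uM M0); split=> //; exists (q \o f).
  exact: surjective_comp.
split; first exact: NM.
move=> MT; have [T' NT'] := top_exists N.
exact: top_iso (top_unique (NM _ NT') MT) NT'.
Qed.

(** The socle: a nonzero cyclic submodule of minimal rank lies in every nonzero
    submodule, by comparability. *)
Lemma uniserial_simple_sub M : uniserial M -> nontrivial M ->
  exists z : set M, [/\ submodule z, z <> [set 0] &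
    forall U, submodule U -> U <> [set 0] -> z `<=` U].
Proof.
move=> [cM [L [r [r1 r2]]]] M0.
have [x [x0 xmin]] := @ex_argmin _ (fun x : M => x <> 0) (fun x => r (cyc x)) M0.
exists (cyc x); split; first exact: submodule_cyc.
  by move=> e; apply: x0; have := cyc_id x; rewrite e.
move=> U hU /(zero_neq hU)[u Uu u0].
apply: (@subset_trans _ (cyc u)); last exact: cyc_sub.
have [//|ux] := cM _ _ (submodule_cyc x) (submodule_cyc u).
apply: contrapT => xu.
have : (r (cyc u) < r (cyc x))%N by apply: r1 => //; exact: submodule_cyc.
by rewrite ltnNge xmin.
Qed.

Lemma uniserial_socle M (z : set M) : submodule z -> z <> [set 0] ->
    (forall U, submodule U -> U <> [set 0] -> z `<=` U) ->
  socle M = z.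
Proof.
move=> hz z0 zmin; apply/seteqP; split.
  apply: smallest_sub => // x [U [hU [[_ U0] sU]] Ux].
  have zU : z `<=` U by apply: zmin => // e; apply: U0; rewrite e.
  have [|e|-> //] := sU z hz _ zU; first by move=> _ ->; exact: sub0.
  by case: z0.
move=> x zx U [hU]; apply; exists z => //; split=> //; split.
  split; first by move=> _ ->; exact: sub0.
  by move=> z0'; apply: z0; apply/seteqP; split=> // _ ->; exact: sub0.
move=> W hW _ Wz; have [->|W0] := pselect (W = [set 0]); first by left.
by right; apply/seteqP; split=> //; exact: zmin.
Qed.

Lemma soc_uniserial M Z : uniserial M -> nontrivial M ->
  is_soc M Z <->
  simple_module Z /\ exists i : {linear Z -> M}, injective_map i.
Proof.
move=> uM M0; have [z [hz z0 zmin]] := uniserial_simple_sub uM M0.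
have zE := uniserial_socle hz z0 zmin; split.
  move=> [i /[dup] iI /injectiveP iI' ir]; rewrite zE in ir.
  split; last by exists i.
  apply/simpleP; split.
    have [x zx x0] := zero_neq hz z0; rewrite -ir in zx.
    have [v _ vx] := zx; exists v => v0; apply: x0.
    by rewrite -vx v0 linear0.
  move=> v v0; apply: subsetT_eq => w _.
  have : z `<=` i @` cyc v.
    apply: zmin; first exact/submodule_image/submodule_cyc.
    move=> e; apply: v0; apply: iI'.
    by rewrite -[_ = 0]/([set 0] (i v)) -e; exists v => //; exact: cyc_id.
  move=> /(_ (i w))[]; first by rewrite -ir; exists w.
  by move=> w' vw' /iI <-.
move=> [/simpleP[Z0 sZ] [i /[dup] iI /injectiveP iI']]; exists i => //.
rewrite zE.
have zr : z `<=` range i.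
  apply: zmin; first exact: submodule_range.
  have [v v0] := Z0; move=> e; apply/v0/iI'.
  by rewrite -[_ = 0]/([set 0] (i v)) -e; exists v.
apply/seteqP; split=> // _ [w _ <-].
have [x zx x0] := zero_neq hz z0.
have [v _ vx] := zr _ zx; subst x.
have v0 : v <> 0 by move=> v0; apply: x0; rewrite v0 linear0.
have : [set: Z] w by [].
by rewrite -(sZ v v0) => -[a _ <-]; rewrite linearZ; exact: subZ.
Qed.

Lemma soc_exists M : exists Z, is_soc M Z.
Proof.
have [Z [i [iI ir]]] := submodule_module (submodule_socle M).
by exists Z, i.
Qed.

Lemma soc_unique M Z Z' : is_soc M Z -> is_soc M Z' -> isomorphic Z Z'.
Proof.
move=> [i iI ir] [j jI jr].
have [h hE] : exists h : {linear Z -> Z'}, forall x, j (h x) = i x.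
  by apply: lift_inj => // x; rewrite jr -ir; exists x.
apply/isomorphicP; exists h; split.
  by move=> x y hxy; apply: iI; rewrite -!hE hxy.
apply/surjectiveP => y.
have : range i (j y) by rewrite ir -jr; exists y.
by move=> [x _ xy]; exists x; apply: jI; rewrite hE.
Qed.

Lemma soc_iso M Z Z' : isomorphic Z Z' -> is_soc M Z -> is_soc M Z'.
Proof.
move=> /iso_sym/isomorphicP[f [fI /surjectiveP fS]] [i iI ir]; exists (i \o f).
  exact: injective_comp.
rewrite -ir; apply/seteqP; split=> _ [x _ <-]; first by exists (f x).
by have [y <-] := fS x; exists y.
Qed.

(** A simple submodule of N is one of M, and a nonzero uniserial module has only
    one simple submodule. *)
Lemma soc_inj M N Z (f : {linear N -> M}) : uniserial M -> nontrivial N ->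
  injective_map f -> is_soc N Z <-> is_soc M Z.
Proof.
move=> uM N0 fI; have uN := uniserial_inj fI uM.
have M0 := nontrivial_inj fI N0.
have NM Z' : is_soc N Z' -> is_soc M Z'.
  move=> /(soc_uniserial _ uN N0)[sZ [i iI]].
  apply/(soc_uniserial _ uM M0); split=> //; exists (f \o i).
  exact: injective_comp.
split; first exact: NM.
move=> MZ; have [Z' NZ'] := soc_exists N.
exact: soc_iso (soc_unique (NM _ NZ') MZ) NZ'.
Qed.

Lemma chain_indecomposable M :
  chain_module M -> nontrivial M -> indecomposable M.
Proof.
move=> cM /nontrivialP M0; split=> // U V hU hV _ UV0.
have [UV|VU] := cM _ _ hU hV.
  by left; rewrite -UV0; apply/esym/setIidPl.
by right; rewrite -UV0; apply/esym/setIidPr.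
Qed.

End Uniserial.

(** * Modules with a unique composition series *)

Section Serial.
Context {R : nzRingType} {M : lmodType R}.
Implicit Types U V W : set M.

Let cover_rel U V := `[< submodule V /\ simple_factor U V >].

Let reach U V := exists p, path cover_rel U p /\ last U p = V.

Lemma composition_seriesP (s : seq (set M)) :
  composition_series s <-> exists p,
    [/\ s = [set 0] :: p, path cover_rel [set 0] p & last [set 0] p = setT].
Proof.
split.
  case: s => [|V p] [hs /= h0 hl hf].
    by have : [set 0 : M] 0 by []; rewrite -h0.
  subst V; exists p; split=> //; apply/(pathP set0) => i ip.
  by apply/asboolP; split; [exact: (hs i.+1)|exact: hf].
move=> [p [-> /(pathP set0) hp hl]]; split=> //.
  move=> [|i] ip /=; first exact: submodule0.
  by have /asboolP[] := hp i ip.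
by move=> i ip; have /asboolP[] := hp i ip.
Qed.

Lemma reach_refl U : reach U U. Proof. by exists [::]. Qed.

Lemma reach_trans U V W : reach U V -> reach V W -> reach U W.
Proof.
move=> [p [hp <-]] [q [hq <-]]; exists (p ++ q).
by rewrite cat_path last_cat hp hq.
Qed.

Lemma reach_step U V : submodule V -> simple_factor U V -> reach U V.
Proof.
move=> hV hUV; exists [:: V] => /=; rewrite andbT; split=> //.
exact/asboolP.
Qed.

Lemma reach_meet V V' U : submodule V -> submodule V' -> submodule U ->
  simple_factor V V' -> reach (V `&` U) (V' `&` U).
Proof.
move=> hV hV' hU [[VV' V'V] sVV'].
have [->|ne] := pselect (V `&` U = V' `&` U); first exact: reach_refl.
apply: reach_step; first exact: submoduleI.
split.
  split; first exact: setSI.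
  by move=> h; apply: ne; apply/seteqP; split=> //; exact: setSI.
move=> W hW UW WU.
have [||| e|e] := sVV' (sum_set V W).
- exact: submodule_sum.
- exact: sum_setl.
- by move=> _ [v Vv [w Ww <-]]; apply: subD => //; [exact: VV'|case: (WU _ Ww)].
- left; apply/seteqP; split=> // w Ww; split; last by case: (WU _ Ww).
  by rewrite -e; exact: sum_setr Ww.
- right; apply/seteqP; split=> // x [V'x Ux].
  move: V'x; rewrite -e => -[v Vv [w Ww vwx]]; rewrite -vwx.
  apply: subD => //; apply: UW; split=> //.
  by apply: (subDr hU (v := w)); [case: (WU _ Ww)|rewrite vwx].
Qed.

Lemma reach_join V V' U : submodule V -> submodule V' -> submodule U ->
  simple_factor V V' -> reach (sum_set V U) (sum_set V' U).
Proof.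
move=> hV hV' hU [[VV' V'V] sVV'].
have sVU : sum_set V U `<=` sum_set V' U.
  by move=> _ [v Vv [u Uu <-]]; exists v; [exact: VV'|exists u].
have [->|ne] := pselect (sum_set V U = sum_set V' U); first exact: reach_refl.
apply: reach_step; first exact: submodule_sum.
split.
  by split=> // h; apply: ne; apply/seteqP.
move=> W hW UW WU.
have VW : V `<=` W by apply: subset_trans UW; exact: sum_setl.
have UW' : U `<=` W by apply: subset_trans UW; exact: sum_setr.
have [||| e|e] := sVV' (W `&` V').
- exact: submoduleI.
- by move=> v Vv; split; [exact: VW|exact: VV'].
- by move=> v [].
- left; apply/seteqP; split=> // w Ww.
  have [v V'v [u Uu vuw]] := WU _ Ww; rewrite -vuw; exists v; last by exists u.
  rewrite -e; split=> //; apply: (subDr hW (v := u)); first exact: UW'.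
  by rewrite vuw.
- right; apply/seteqP; split=> // _ [v V'v [u Uu <-]].
  by apply: subD => //; [move: V'v; rewrite -e => -[]|exact: UW'].
Qed.

Lemma path_lift (F : set M -> set M) V p :
  (forall W W', submodule W -> submodule W' -> simple_factor W W' ->
     reach (F W) (F W')) ->
  submodule V -> path cover_rel V p -> reach (F V) (F (last V p)).
Proof.
move=> hF; elim: p V => [|W p IHp] V hV /=; first by move=> _; exact: reach_refl.
move=> /andP[/asboolP[hW hVW] hp].
exact: reach_trans (hF _ _ hV hW hVW) (IHp _ hW hp).
Qed.

(** Intersecting with U and adding U refine a composition series to one that
    passes through U; uniqueness then puts U in the given series. *)
Lemma serial_submodule p U :
  (forall q, composition_series q -> [set 0] :: p = q) ->
  path cover_rel [set 0] p -> last [set 0] p = setT -> submodule U ->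
  exists2 i, (i < (size p).+1)%N & nth set0 ([set 0] :: p) i = U.
Proof.
move=> up hp hl hU.
have [p1 [hp1 l1]] : reach [set 0] U.
  have := path_lift (F := fun V => V `&` U) _ (@submodule0 _ _) hp.
  rewrite hl setTI (_ : [set 0] `&` U = [set 0]).
    by apply=> *; exact: reach_meet.
  by apply/setIidPl => _ ->; exact: sub0.
have [p2 [hp2 l2]] : reach U setT.
  have := path_lift (F := fun V => sum_set V U) _ (@submodule0 _ _) hp.
  rewrite hl (_ : sum_set setT U = setT); last first.
    by apply: subsetT_eq; exact: sum_setl.
  rewrite (_ : sum_set [set 0] U = U); first by apply=> *; exact: reach_join.
  apply/seteqP; split; last exact/sum_setr/submodule0.
  by move=> _ [_ -> [u Uu <-]]; rewrite add0r.
have [e] : [set 0] :: p = [set 0] :: (p1 ++ p2).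
  apply: up; apply/composition_seriesP; exists (p1 ++ p2).
  by rewrite cat_path last_cat l1 hp1 hp2.
exists (size p1); first by rewrite e size_cat ltnS leq_addr.
by rewrite e -cat_cons nth_cat /= ltnSn -[RHS]l1 (last_nth set0).
Qed.

Lemma serial_uniserial : serial M -> uniserial M.
Proof.
move=> [s [cs us]].
have /composition_seriesP[p [sE hp hl]] := cs; subst s.
have inp := serial_submodule us hp hl.
have mono i j : (i <= j)%N -> (j < (size p).+1)%N ->
    nth set0 ([set 0] :: p) i `<=` nth set0 ([set 0] :: p) j.
  elim: j => [|j IHj]; first by rewrite leqn0 => /eqP -> _.
  rewrite leq_eqVlt => /orP[/eqP -> _ //|ij jp].
  apply: subset_trans (IHj ij (ltnW jp)) _.
  by have /(pathP set0)/(_ j jp)/asboolP[_ [[]]] := hp.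
split.
  move=> U V hU hV; have [i ip <-] := inp _ hU; have [j jp <-] := inp _ hV.
  by have [ij|/ltnW ji] := leqP i j; [left|right]; exact: mono.
exists (size p).+1.
(* the rank counts the terms of the composition series inside U *)
pose f (U : set M) (i : 'I_(size p).+1) : nat :=
  `[< nth set0 ([set 0] :: p) i `<=` U >].
exists (fun U => \sum_i f U i)%N; split; last first.
  move=> V hV _; rewrite -[leqRHS]card_ord -sum1_card.
  by apply: leq_sum => i _; exact: leq_b1.
move=> U V hU hV [UV VU] _; have [j jp jV] := inp _ hV.
rewrite (bigD1 (Ordinal jp)) //= [ltnRHS](bigD1 (Ordinal jp)) //=.
rewrite -addSn; apply: leq_add.
  rewrite /f /= jV; case: asboolP => // _.
  by have -> : `[< V `<=` V >] by apply/asboolP.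
apply: leq_sum => i _; rewrite /f.
case: asboolP => // iU.
by have -> : `[< nth set0 ([set 0] :: p) i `<=` V >]
  by apply/asboolP; exact: subset_trans UV.
Qed.

End Serial.

(** * Projective covers, syzygies and projective dimension *)

Section Projective.
Context {R : nzRingType}.
Implicit Types M N K Q P X : lmodType R.

Lemma projective_retract P Q (i : {linear Q -> P}) (r : {linear P -> Q}) :
  (forall x, r (i x) = x) -> projective P -> projective Q.
Proof.
move=> ri pP X Y g f gS.
have [h hE] := pP X Y g (f \o r) gS.
by exists (h \o i) => x /=; have := hE (i x); rewrite /= ri.
Qed.

Lemma projective_iso P Q : isomorphic P Q -> projective P -> projective Q.
Proof.
move=> /isomorphicP[f [fI /surjectiveP fS]].
have fT y : range f (idfun y : Q) by have [x <-] := fS y; exists x.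
have [g gE] := lift_inj fI fT.
exact: projective_retract gE.
Qed.

Lemma free_map M (x : M) : exists f : {linear R^o -> M}, forall a, f a = a *: x.
Proof.
have lf : linear (fun a : R^o => a *: x).
  by move=> a u v; rewrite scalerDl scalerA.
by exists (lin lf).
Qed.

Lemma projective_free : projective R^o.
Proof.
move=> X Y g f /surjectiveP gS; have [x gx] := gS (f 1).
have [h hE] := free_map x; exists h => a /=.
by rewrite hE linearZ gx -linearZ /= /GRing.scale /= mulr1.
Qed.

Lemma projective_split P M (p : {linear M -> P}) :
  projective P -> surjective_map p ->
  exists s : {linear P -> M}, forall x, p (s x) = x.
Proof. by move=> pP pS; have [s sE] := pP _ _ p idfun pS; exists s. Qed.

Lemma chain_superfluous M (U : set M) :
  chain_module M -> submodule U -> U <> setT -> superfluous U.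
Proof.
move=> cM hU UT V hV UV; have [UsV|VsU] := cM _ _ hU hV.
  apply: subsetT_eq; rewrite -UV => _ [u Uu [v Vv <-]].
  by apply: subD => //; exact: UsV.
case: UT; apply: subsetT_eq; rewrite -UV => _ [u Uu [v Vv <-]].
by apply: subD => //; exact: VsU.
Qed.

(** A map into P that is onto modulo a superfluous submodule is onto. *)
Lemma cover_surj P M N (p : {linear P -> M}) (f : {linear N -> P}) :
  superfluous (kernel p) -> (forall y, exists x, p (f x) = p y) ->
  surjective_map f.
Proof.
move=> sk pf; apply: sk; first exact: submodule_range.
apply: subsetT_eq => y _; have [x pfx] := pf y.
exists (y - f x); first by rewrite /kernel /= linearB pfx subrr.
by exists (f x); [exists x|rewrite subrK].
Qed.

(** The lift of phi is onto because the kernel of p' is superfluous; it splits,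
    and the splitting is onto because the kernel of p is superfluous. *)
Lemma projective_cover_lift P P' M M' (p : {linear P -> M})
    (p' : {linear P' -> M'}) (phi : {linear M -> M'}) :
  projective_cover p -> projective_cover p' ->
  injective_map phi -> surjective_map phi ->
  exists f : {linear P -> P'},
    [/\ injective_map f, surjective_map f & forall x, p' (f x) = phi (p x)].
Proof.
move=> [pP pS pk] [pP' pS' pk'] phiI phiS.
have [f fE] := pP _ _ p' (phi \o p) pS'.
have fS : surjective_map f.
  apply: (cover_surj pk') => y.
  have [x xy] := (surjectiveP _).1 phiS (p' y) => //.
  have [z zx] := (surjectiveP _).1 pS x.
  by exists z; have /= -> := fE z; rewrite zx.
exists f; split=> //.
have [s sE] := projective_split pP' fS.
have sS : surjective_map s.
  apply: (cover_surj pk) => y; exists (f y); apply: phiI.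
  by have /= <- := fE (s (f y)); rewrite sE; have /= -> := fE y.
apply/injectiveP => x; have [y <-] := (surjectiveP _).1 sS x.
by rewrite sE => ->; rewrite linear0.
Qed.

Lemma PC_iso M M' P P' :
  isomorphic M M' -> is_PC M P -> is_PC M' P' -> isomorphic P P'.
Proof.
move=> /isomorphicP[phi [phiI phiS]] [p pc] [p' pc'].
have [f [fI fS _]] := projective_cover_lift pc pc' phiI phiS.
by apply/isomorphicP; exists f.
Qed.

Lemma syzygy_unique M M' K K' :
  isomorphic M M' -> is_syzygy M K -> is_syzygy M' K' -> isomorphic K K'.
Proof.
move=> /isomorphicP[phi [/[dup] phiI /injectiveP phi0 phiS]].
move=> [P [p [i [pc iI ik]]]] [P' [p' [i' [pc' iI' ik']]]].
have [f [fI fS fE]] := projective_cover_lift pc pc' phiI phiS.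
have [h hE] : exists h : {linear K -> K'}, forall x, i' (h x) = (f \o i) x.
  apply: lift_inj => // x; rewrite ik' /kernel /= fE.
  have -> : p (i x) = 0 by change (kernel p (i x)); rewrite -ik; exists x.
  exact: linear0.
apply/isomorphicP; exists h; split.
  by move=> x y hxy; apply/iI/fI; have /= <- := hE x; rewrite hxy hE.
apply/surjectiveP => y; have [z zy] := (surjectiveP _).1 fS (i' y).
have : kernel p z.
  apply: phi0; rewrite -fE zy; change (kernel p' (i' y)).
  by rewrite -ik'; exists y.
rewrite -ik => -[x _ xz]; exists x; apply: iI'.
by rewrite hE /= xz.
Qed.

Lemma syzygy_isol M M' K : isomorphic M M' -> is_syzygy M K -> is_syzygy M' K.
Proof.
move=> /isomorphicP[f [/injectiveP fI fS]] [P [p [i [[pP pS pk] iI ik]]]].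
have fpk : kernel (f \o p) = kernel p.
  apply/seteqP; split=> x; rewrite /kernel /=; first exact: fI.
  by move=> ->; rewrite linear0.
exists P, (f \o p), i; split=> //; last by rewrite fpk.
by split=> //; [exact: surjective_comp|rewrite fpk].
Qed.

Lemma PC_syzygy M P : is_PC M P -> exists K, is_syzygy M K.
Proof.
move=> [p pc]; have [K [i [iI ik]]] := submodule_module (submodule_ker p).
by exists K, P, p, i.
Qed.

(** If M is projective, a cover of M splits and its kernel is a superfluous
    summand, hence zero. *)
Lemma syzygy_projective M K : is_syzygy M K -> ~ nontrivial K <-> projective M.
Proof.
move=> [P [p [i [[pP pS pk] iI ik]]]]; split.
  move=> K0; apply: (projective_iso _ pP); apply/isomorphicP; exists p.
  split=> //; apply/injectiveP => x px.
  have : range i x by rewrite ik.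
  by move=> [y _ <-]; rewrite (trivialP K0 y) linear0.
move=> pM [y y0]; apply: y0; have [s sE] := projective_split pM pS.
have sS : surjective_map s.
  by apply: (cover_surj pk) => x; exists (p x); rewrite sE.
have [z zy] := (surjectiveP _).1 sS (i y).
have : p (i y) = 0 by change (kernel p (i y)); rewrite -ik; exists y.
rewrite -zy sE => z0; move: zy; rewrite z0 linear0 => /esym.
exact/(injectiveP _).1.
Qed.

Lemma resolution_projective M :
  projective M -> proj_resolution_of_length M 0.
Proof.
move=> pM; pose P i : lmodType R := if i is _.+1 then 'rV[R]_0 else M.
have l0 i : linear (fun _ : P i.+1 => 0 : P i).
  by move=> a x y; rewrite scaler0 addr0.
have P0 i (x : P i.+1) : x = 0 by exact: thinmx0.
have T0 i : [set 0 : P i.+1] = setT.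
  by apply: subsetT_eq => x _; exact: P0.
exists P, (fun i => lin (l0 i)), idfun; split.
- case=> [//|i] X Y g f gS.
  have lz : linear (fun _ : P i.+1 => 0 : X).
    by move=> a x y; rewrite scaler0 addr0.
  exists (lin lz) => x; rewrite /= [x]P0.
  by rewrite !linear0.
- by case.
- by apply/surjectiveP => y; exists y.
- apply/seteqP; split=> [_ [x _ <-] //|x]; rewrite /kernel /= => ->.
  by exists 0.
- move=> i; apply/seteqP; split=> [_ [x _ <-] //|x _].
  by exists 0 => //=; rewrite [RHS]P0.
Qed.

Lemma resolution_syzygy M K n : is_syzygy M K ->
  proj_resolution_of_length K n -> proj_resolution_of_length M n.+1.
Proof.
move=> [P0 [p [i [[pP0 pS pk] iI ik]]]] [P [d [eps [pP nP epsS e0 ex]]]].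
pose P' j : lmodType R := if j is j.+1 then P j else P0.
pose d' j : {linear P' j.+1 -> P' j} :=
  match j return {linear P' j.+1 -> P' j} with
  | 0 => (i \o eps : {linear P 0%N -> P0}) | j.+1 => d j end.
exists P', d', p; split=> //.
- by case.
- by case=> [//|j] nj; exact: nP.
- rewrite -ik; apply/seteqP; split=> _ [x _ <-]; first by exists (eps x).
  by have [y <-] := (surjectiveP _).1 epsS x; exists y.
- case=> [|j]; last exact: ex.
  rewrite /= e0; apply/seteqP; split=> x; rewrite /kernel /=.
    by move=> ->; rewrite linear0.
  exact/(injectiveP _).1.
Qed.

Lemma resolution_iso M M' n : isomorphic M M' ->
  proj_resolution_of_length M n -> proj_resolution_of_length M' n.
Proof.
move=> /isomorphicP[f [/injectiveP fI fS]] [P [d [eps [pP nP epsS e0 ex]]]].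
exists P, d, (f \o eps); split=> //; first exact: surjective_comp.
rewrite e0; apply/seteqP; split=> x; rewrite /kernel /=; last exact: fI.
by move=> ->; rewrite linear0.
Qed.

Lemma pd_iso M M' : isomorphic M M' -> pd M = pd M'.
Proof.
move=> MM'; rewrite /pd.
have -> : proj_resolution_of_length M = proj_resolution_of_length M'.
  apply/funext => n; apply/propext; split; apply: resolution_iso => //.
  exact: iso_sym.
by [].
Qed.

Lemma pd_le_resolution M n m :
  ((n%:Z)%:E <= pd M)%E -> proj_resolution_of_length M m -> (n <= m)%N.
Proof.
rewrite /pd => + Mm; case: pselect => [exn|[]]; last first.
  by exists m; apply/asboolP.
case: ex_minnP => l _ minl; rewrite lee_fin lez_nat => nl.
by apply: leq_trans nl _; apply: minl; apply/asboolP.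
Qed.

Lemma resolution_iter M K n m : rel_iter n is_syzygy M K ->
  proj_resolution_of_length K m -> proj_resolution_of_length M (n + m).
Proof.
elim: n K m => [|n IHn] K m /=.
  by move=> MK; apply: resolution_iso; exact: iso_sym.
move=> [K' MK' K'K] Km; rewrite addSnnS; apply: IHn MK' _.
exact: resolution_syzygy Km.
Qed.

(** A minimal resolution can stop only after a projective syzygy, and then it is
    a resolution showing that pd M < n. *)
Lemma syzygy_nontrivial M K n : nontrivial M -> ((n%:Z)%:E <= pd M)%E ->
  rel_iter n is_syzygy M K -> nontrivial K.
Proof.
move=> M0 pdM; case: n pdM => [|n] pdM /=; first by move=> /nontrivial_iso; apply.
move=> [K' MK' K'K]; apply: contrapT => /(syzygy_projective K'K) pK'.
have := resolution_iter MK' (resolution_projective pK').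
by move=> /(pd_le_resolution pdM); rewrite addn0 ltnn.
Qed.

End Projective.

Section SerialRing.
Context {R : nzRingType}.
Implicit Types M N K Q P X : lmodType R.
Hypothesis hN : forall M : lmodType R, fin_gen M -> indecomposable M -> serial M.

Lemma fin_gen_uniserial M :
  fin_gen M -> (nontrivial M -> indecomposable M) -> uniserial M.
Proof.
move=> fM iM; have [/iM|] := pselect (nontrivial M).
  by move=> ?; exact/serial_uniserial/hN.
exact: uniserial_trivial.
Qed.

(** A cyclic M has a cyclic cover P.  If P is the direct sum of U and V, the
    images of U and V in M are comparable, so one of them is M; that summand is
    then P, the kernel of p being superfluous. *)
Lemma cover_uniserial P M (p : {linear P -> M}) :
  projective_cover p -> uniserial M -> uniserial P.
Proof.
move=> [pP pS pk] uM; have [x xT] := uniserial_cyclic uM.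
have [u ux] := (surjectiveP _).1 pS x.
have uT : cyc u = setT.
  apply: pk; first exact: submodule_cyc.
  apply: subsetT_eq => y _; have : [set: M] (p y) by [].
  rewrite -xT => -[a _ ay]; exists (y - a *: u).
    by rewrite /kernel /= linearB linearZ /= ux ay subrr.
  by exists (a *: u); [exists a|rewrite subrK].
apply: fin_gen_uniserial; first exact: cyclic_fin_gen uT.
move=> /nontrivialP P0; split=> // U V hU hV UV UV0.
have half (U' V' : set P) : submodule U' -> submodule V' ->
    sum_set U' V' = setT -> U' `&` V' = [set 0] ->
    p @` V' `<=` p @` U' -> V' = [set 0].
  move=> hU' hV' UV' UV0' VU.
  have U'T : U' = setT.
    apply: pk => //; apply: subsetT_eq => y _; have : [set: P] y by [].
    rewrite -UV' => -[a U'a [b V'b <-]].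
    have [c U'c pc] : (p @` U') (p b) by apply: VU; exists b.
    exists (b - c); first by rewrite /kernel /= linearB pc subrr.
    by exists (a + c); [exact: subD|rewrite addrCA subrK].
  by move: UV0'; rewrite U'T setTI.
have [|] := uM.1 _ _ (submodule_image p hU) (submodule_image p hV).
  by left; apply: (half V U) => //; rewrite 1?sum_setC 1?setIC.
by right; exact: (half U V).
Qed.

Lemma syzygy_uniserial M K : is_syzygy M K -> uniserial M -> uniserial K.
Proof.
by move=> [P [p [i [pc iI _]]]] /(cover_uniserial pc); exact: uniserial_inj iI.
Qed.

End SerialRing.

(** * Factoring maps through a minimal presentation of a simple module *)

Section Factorisation.
Context {R : nzRingType}.
Hypothesis hN : forall M : lmodType R, fin_gen M -> indecomposable M -> serial M.
Context {P0 P1 Q : lmodType R} (a : {linear P1 -> P0}) (m1 : set P1).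
Hypotheses (pP0 : projective P0) (uQ : uniserial Q) (lm1 : local_at m1)
  (la : local_at (range a)) (a_neq0 : exists u, a u <> 0).

Let P0xQ : lmodType R := (P0 * Q)%type.

Lemma local_kernel (N : lmodType R) (f : {linear P1 -> N}) :
  (exists u, f u <> 0) -> forall u, f u = 0 -> m1 u.
Proof.
move=> [v fv] u fu; apply: (local_sub lm1 (submodule_ker f)) fu => kT.
by apply: fv; change (kernel f v); rewrite kT.
Qed.

Section Step.
Context (g : {linear P1 -> Q}) (gS : ~ surjective_map g).
Hypothesis g_neq0 : exists u, g u <> 0.

Let rad_g : set Q := g @` m1.

Let hm1 : submodule m1. Proof. by case: lm1. Qed.
Let hrad_g : submodule rad_g. Proof. exact: submodule_image. Qed.

(** The relations that define the pushout of P0 and Q / rad_g along P1; the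
    image of P1 in the pushout is the class of (0, range g), a simple module. *)
Definition amalgam : set P0xQ :=
  [set z | exists2 u, z.1 = a u & rad_g (z.2 + g u)].

Lemma submodule_amalgam : submodule amalgam.
Proof.
apply/submoduleP; split.
  by exists 0; rewrite /= ?linear0// addr0; exact: sub0.
move=> c [y x] [y' x'] [u /= -> xu] [u' /= -> xu']; exists (c *: u + u').
  by rewrite /= linearP.
rewrite /= linearP addrACA -scalerDr; apply: subD => //; exact: subZ.
Qed.

(** g induces an isomorphism from the top of P1 to that of the image of g. *)
Lemma rad_image u : rad_g (g u) -> m1 u.
Proof.
move=> [w mw gwu]; apply: (subDr hm1 (subN hm1 mw)).
by apply: (local_kernel g_neq0); rewrite linearB gwu subrr.
Qed.

Lemma amalgam0 z : amalgam (0, z) -> rad_g z.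
Proof.
move=> [u /= /esym au0 zu]; apply: (subDr hrad_g _ zu); exists u => //.
exact: (local_kernel a_neq0).
Qed.

Context (W : lmodType R) (q : {linear P0xQ -> W}).
Hypotheses (qS : surjective_map q) (qk : kernel q = amalgam).

Let q0 z : q z = 0 <-> amalgam z. Proof. by rewrite -qk. Qed.

Let iQ (x : Q) : P0xQ := (0, x).
Let liQ : linear iQ.
Proof. by move=> c x y; apply/pair_equal_spec; rewrite /= scaler0 addr0. Qed.
Let iP (y : P0) : P0xQ := (y, 0).
Let liP : linear iP.
Proof. by move=> c x y; apply/pair_equal_spec; rewrite /= scaler0 addr0. Qed.

Let qa u x : q (a u, x) = q (0, x + g u).
Proof.
apply/subr0_eq; rewrite -linearB; apply/q0; exists u => /=; first exact: subr0.
by rewrite opprD addrA subrr sub0r addNr; exact: sub0.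
Qed.

(** The images of P0 and Q are incomparable: the range of a is not P0 and g is
    not onto. *)
Lemma amalgam_not_chain : ~ chain_module W.
Proof.
move=> cW.
pose qP : {linear P0 -> W} := q \o lin liP.
pose qQ : {linear Q -> W} := q \o lin liQ.
have [PQ|QP] := cW _ _ (submodule_range qP) (submodule_range qQ).
  have [y ya] := local_point la; apply: ya.
  have [|x _ /= qx] := PQ (q (y, 0)); first by exists y.
  have : q ((y, 0) - (0, x)) = 0 by rewrite linearB -qx subrr.
  by move=> /q0[u /= + _]; rewrite subr0 => ->; exists u.
apply/gS/surjectiveP => x.
have [|y _ /= qy] := QP (q (0, x)); first by exists x.
have : q ((0, x) - (y, 0)) = 0 by rewrite linearB -qy subrr.
move=> /q0[u /= _ [w _]]; rewrite subr0 => gw; exists (w - u).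
by rewrite linearB gw addrK.
Qed.

(** A submodule of the pushout that avoids the image of P1 is the graph of a map
    on P0, modulo the relations: by comparability in P0 and in Q, an element (y, x)
    of it outside the relations has y outside the range of a, and then y
    generates P0, whereas an element (0, z) of it has z in rad_g. *)
Lemma graph_of_submodule (U : set W) v1 : submodule U -> U <> [set 0] ->
  ~ m1 v1 -> ~ U (q (0, g v1)) ->
  exists h : {linear P0 -> Q}, forall u, rad_g (g u - h (a u)).
Proof.
move=> hU /(zero_neq hU)[w Uw w0] mv1 Uv1.
have qZ c x : q (0, c *: x) = c *: q (0, x).
  rewrite -linearZ; congr (q _).
  by apply/pair_equal_spec; rewrite /= scaler0.
have inU z : U (q (0, z)) -> rad_g z.
  move=> Uz; apply: contrapT => rz; apply: Uv1.
  have [[v _ vz]|gz] := pselect (range g z).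
    subst z; have mv : ~ m1 v by move=> mv; apply: rz; exists v.
    have : [set: P1] v1 by [].
    case: lm1 => _ _ /(_ v mv) <- [c _ <-].
    by rewrite linearZ /= qZ; exact: subZ.
  have [zg|gz'] := uQ.1 _ _ (submodule_cyc z) (submodule_range g).
    by case: gz; apply/zg/cyc_id.
  have [|c _ <-] := gz' (g v1); first by exists v1.
  by rewrite qZ; exact: subZ.
have [[y x] qyx] := (surjectiveP _).1 qS w.
have ya : ~ range a y.
  move=> [u _ uy]; apply: w0; rewrite -qyx; apply/q0.
  by exists u => //=; apply: inU; rewrite -qa uy qyx.
have hL := submodule_preim q hU.
have [K [i [iI ir]]] := submodule_module hL.
have lfst : linear (fun z : K => (i z).1) by move=> c z z'; rewrite linearP.
have [|s sE] := projective_split (p := lin lfst) pP0.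
  apply/surjectiveP => b; have : [set: P0] b by [].
  case: la => _ _ /(_ y ya) <- [c _ <-].
  have : range i (c *: y, c *: x).
    by rewrite ir /= -[(_, _)]/(c *: ((y, x) : P0xQ)) linearZ /= qyx; exact: subZ.
  by move=> [z _ zE]; exists z; rewrite /= zE.
have lh : linear (fun b : P0 => - (i (s b)).2).
  move=> c b b'.
  have -> : i (s (c *: b + b')) = c *: i (s b) + i (s b') by rewrite !linearP.
  change (- (c *: (i (s b)).2 + (i (s b')).2) = c *: - (i (s b)).2 - (i (s b')).2).
  by rewrite opprD scalerN.
exists (lin lh) => u /=; apply: inU.
have Us b : U (q (b, (i (s b)).2)).
  have e : (i (s b)).1 = b by have := sE b.
  by rewrite -{1}e -surjective_pairing -[U _]/((q @^-1` U) _) -ir; exists (s b).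
by rewrite opprK addrC -qa.
Qed.

End Step.

(** The pushout is finitely generated and has incomparable submodules, so it
    decomposes; the image of P1, being simple, meets one summand in 0. *)
Lemma factor_modulo_radical (g : {linear P1 -> Q}) :
  ~ surjective_map g -> (exists u, g u <> 0) ->
  exists h : {linear P0 -> Q}, forall u, (g @` m1) (g u - h (a u)).
Proof.
move=> gS g0; apply: contrapT => noh.
have [v1 mv1] := local_point lm1.
have [W [q [qS qk]]] := quotient_module (submodule_amalgam g).
apply: (amalgam_not_chain gS qk).
suff uW : uniserial W by case: uW.
have [y0 y0T] : exists y : P0, cyc y = setT.
  by have [y ya] := local_point la; exists y; case: la => _ _; apply.
have [x0 x0T] := uniserial_cyclic uQ.
apply: (fin_gen_uniserial hN).
  exists 2%N, (fun i : 'I_2 => if i == 0 then q (y0, 0) else q (0, x0)) => w.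
  have [[y x] <-] := (surjectiveP _).1 qS w.
  have : [set: P0] y by [].
  rewrite -y0T => -[b _ <-].
  have : [set: Q] x by [].
  rewrite -x0T => -[c _ <-].
  exists (fun i : 'I_2 => if i == 0 then b else c).
  rewrite big_ord_recl big_ord1 /= -!linearZ -linearD; congr (q _).
  by apply/pair_equal_spec; rewrite /= !scaler0 addr0 add0r.
move=> /nontrivialP W0; split=> // U V hU hV _ UV0.
have [|U0] := pselect (U = [set 0]); first by left.
have [|V0] := pselect (V = [set 0]); first by right.
exfalso; apply: noh.
(* the class of (0, g v1) generates the image of P1 in the pushout *)
have [Uv|] := pselect (U (q (0, g v1))); last first.
  exact: graph_of_submodule.
have [Vv|] := pselect (V (q (0, g v1))); last first.
  exact: graph_of_submodule.
exfalso; apply: mv1; apply: (rad_image g0); apply: amalgam0.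
rewrite -qk; change ([set 0] (q (0, g v1))); by rewrite -UV0; split.
Qed.

(** Correct g modulo the radical of its image, and repeat with the difference,
    whose image is strictly smaller. *)
Lemma factor_through (g : {linear P1 -> Q}) :
  ~ surjective_map g -> exists h : {linear P0 -> Q}, forall u, g u = h (a u).
Proof.
have [cQ [L [r [r1 r2]]]] := uQ.
have [n] := ubnP (r (range g)); elim: n g => // n IHn g rn gS.
have [g0|g0] := pselect (exists u, g u <> 0); last first.
  have l0 : linear (fun _ : P0 => 0 : Q) by move=> c x y; rewrite scaler0 addr0.
  exists (lin l0) => u /=; apply: contrapT => gu; apply: g0; by exists u.
have [h hE] := factor_modulo_radical gS g0.
have lg' : linear (fun u => g u - h (a u)).
  move=> c x y.
  by rewrite (linearP g) (linearP a) (linearP h) opprD addrACA scalerBr.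
pose g' := lin lg'.
have hr := submodule_range g'.
have rg : range g' `<` range g.
  split.
    by move=> _ [u _ <-] /=; have [w _ <-] := hE u; exists w.
  have [v1 mv1] := local_point lm1.
  move=> /(_ (g v1))[]; first by exists v1.
  move=> u _ /= gu; apply: mv1; apply: (rad_image g0).
  by rewrite -gu; exact: hE.
have rn' : (r (range g') < n)%N.
  apply: leq_trans (r1 _ _ hr (submodule_range g) rg (@subsetT _ _)) _.
  by rewrite -ltnS.
have [|h' h'E] := IHn g' rn'.
  move=> /surjectiveP g'S; apply/gS/surjectiveP => x.
  have [u ux] := g'S x; have [//|w _ gw] := rg.1 x; first by exists u.
  by exists w.
have lh : linear (fun b : P0 => h b + h' b).
  by move=> c x y; rewrite (linearP h) (linearP h') addrACA scalerDr.
by exists (lin lh) => u /=; rewrite -h'E /= addrC subrK.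
Qed.

End Factorisation.

(** * Essential extensions and injective envelopes *)

Section Injective.
Context {R : nzRingType}.
Implicit Types M N K Q X Y E I : lmodType R.

Lemma submodule_chain M (F : set (set M)) : F !=set0 ->
  (forall U, F U -> submodule U) -> total_on F subset ->
  submodule (\bigcup_(U in F) U).
Proof.
move=> [U0 FU0] hF tF; apply/submoduleP; split.
  by exists U0 => //; exact: sub0 (hF _ FU0).
move=> a u v uF vF; have [U [FU Uu Uv]] := chain_bigcup_pair tF uF vF.
by exists U => //; have hU := hF _ FU; apply: subD => //; exact: subZ.
Qed.

Lemma meet_eq0 M (U V : set M) : submodule U -> submodule V ->
  (forall x, U x -> V x -> x = 0) -> U `&` V = [set 0].
Proof.
move=> hU hV UV; apply/seteqP; split=> [x [Ux Vx]|_ ->]; first exact: UV.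
by split; exact: sub0.
Qed.

Lemma injective_retract I Q (i : {linear Q -> I}) (r : {linear I -> Q}) :
  (forall x, r (i x) = x) -> injective_module I -> injective_module Q.
Proof.
move=> ri iI X Y g f gI; have [h hE] := iI X Y g (i \o f) gI.
by exists (r \o h) => x /=; have /= -> := hE x.
Qed.

(** Modulo a maximal complement of U, the image of U is essential. *)
Lemma complement_exists M (U : set M) : submodule U ->
  exists V : set M, [/\ submodule V, U `&` V = [set 0] &
    forall W, submodule W -> V `<=` W -> U `&` W = [set 0] -> W = V].
Proof.
move=> hU.
have [||V [[hV UV] Vmax]] := @Zorn_nonempty M
    [set V | submodule V /\ U `&` V = [set 0]] [set 0].
- split; first exact: submodule0.
  by apply/seteqP; split=> [x []//|_ ->]; split=> //; exact: sub0.
- move=> F F0 FP tF.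
  have hbig : submodule (\bigcup_(A in F) A).
    by apply: submodule_chain => // V /FP[].
  split=> //; apply/seteqP; split=> [x [Ux [V FV Vx]]|_ ->].
    by have [_ <-] := FP _ FV.
  by split; exact: sub0.
by exists V; split=> // W hW VW UW; apply: Vmax.
Qed.

Lemma essential_inj M N X (i : {linear M -> N}) (f : {linear N -> X}) :
  essential (range i) -> injective_map (f \o i) -> injective_map f.
Proof.
move=> ei /injectiveP fiI; apply/injectiveP.
have hk := submodule_ker f.
suff k0 : kernel f = [set 0] by move=> x fx; rewrite -[_ = 0]/([set 0] x) -k0.
apply: ei => //; apply/seteqP; split; last first.
  by move=> _ ->; split; [exact: sub0 (submodule_range i)|exact: sub0 hk].
by move=> _ [[x _ <-]]; rewrite /kernel /= => /fiI ->; rewrite linear0.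
Qed.

(** A submodule E of I that is maximal among the essential extensions of M is a
    direct summand of I: if U is a maximal complement of E, then E is essential
    in I / U, which embeds in I over E and so is again E, by maximality. *)
Lemma injective_envelope_exists M I (j : {linear M -> I}) :
  injective_module I -> injective_map j -> exists Q, is_IE M Q.
Proof.
move=> iI jI.
pose ess (E : set I) := [/\ submodule E, range j `<=` E &
  forall V, submodule V -> V `<=` E -> range j `&` V = [set 0] -> V = [set 0]].
have hj := submodule_range j.
have [||E [[hE jE eE] Emax]] := @Zorn_nonempty I ess (range j).
- split=> // V hV Vj <-; apply/seteqP; split=> [x Vx|x []//].
  by split=> //; exact: Vj.
- move=> F [E0 FE0] FP tF; split.
  + by apply: submodule_chain => //; [exists E0|move=> E /FP[]].
  + by have [_ jE0 _] := FP _ FE0; move=> x /jE0; exists E0.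
  + move=> V hV VF jV0; apply/seteqP; split=> [x Vx|_ ->]; last exact: sub0.
    have [E FE Ex] := VF _ Vx; have [hE _ eE] := FP _ FE.
    have VE0 : V `&` E = [set 0].
      apply: eE; [exact: submoduleI|by move=> ? []|].
      apply: meet_eq0 => //; first exact: submoduleI.
      by move=> y jy [Vy _]; rewrite -[_ = 0]/([set 0] y) -jV0.
    by rewrite -VE0.
have [U [hU EU Umax]] := complement_exists hE.
have [W [q [qS qk]]] := quotient_module hU.
have [K [i [iI' ir]]] := submodule_module hE.
have qiI : injective_map (q \o i).
  apply/injectiveP => x /= qix; apply: ((injectiveP _).1 iI').
  rewrite -[_ = 0]/([set 0] (i x)) -EU; split; first by rewrite -ir; exists x.
  by rewrite -qk.
have eqi : essential (range (q \o i)).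
  move=> V hV qV0; apply/seteqP; split=> [w Vw|_ ->]; last exact: sub0.
  have [x xw] := (surjectiveP _).1 qS w; subst w.
  have qU u : U u -> q u = 0 by rewrite -qk.
  suff VU : q @^-1` V = U by apply: qU; rewrite -VU.
  apply: Umax; first exact: submodule_preim.
    by move=> u Uu /=; rewrite qU//; exact: sub0.
  apply: meet_eq0 => //; first exact: submodule_preim.
  move=> y; rewrite -ir => -[z _ <-] /= Vz.
  have : q (i z) = 0.
    by rewrite -[_ = 0]/([set 0] (q (i z))) -qV0; split=> //; exists z.
  by have /injectiveP qi0 := qiI; move=> /qi0 ->; rewrite linear0.
(* psi embeds I / U into I over E *)
have [psi psiE] := iI _ _ (q \o i) i qiI.
have psiI : injective_map psi.
  apply: (essential_inj eqi) => x y.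
  by move=> pxy; apply: iI'; rewrite -!psiE.
have psiR : range psi = E.
  have Epsi : E `<=` range psi.
    move=> y; rewrite -ir => -[z _ <-]; exists (q (i z)) => //.
    exact: psiE.
  apply: Emax => //; split; first exact: submodule_range.
    exact: subset_trans Epsi.
  move=> V hV Vpsi jV0.
  have VE0 : E `&` V = [set 0].
    apply: eE; [exact: submoduleI|by move=> ? []|].
    apply: meet_eq0 => //; first exact: submoduleI.
    by move=> y jy [_ Vy]; rewrite -[_ = 0]/([set 0] y) -jV0.
  have : psi @^-1` V = [set 0].
    apply: eqi; first exact: submodule_preim.
    apply: meet_eq0; [exact: submodule_range|exact: submodule_preim|].
    move=> _ [z _ <-] /= Vz.
    suff -> : i z = 0 by rewrite linear0.
    rewrite -[_ = 0]/([set 0] (i z)) -VE0; split; first by rewrite -ir; exists z.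
    by have /= <- := psiE z.
  move=> pV; apply/seteqP; split=> [y Vy|_ ->]; last exact: sub0.
  have [w _ wy] := Vpsi _ Vy; subst y.
  have : (psi @^-1` V) w by [].
  by rewrite pV => ->; exact: linear0.
(* psi o q retracts I onto E *)
have [r rE] : exists r : {linear I -> K}, forall x, i (r x) = (psi \o q) x.
  by apply: lift_inj => // x; rewrite ir -psiR; exists (q x).
have [j' j'E] : exists j' : {linear M -> K}, forall x, i (j' x) = j x.
  by apply: lift_inj => // x; rewrite ir; apply: jE; exists x.
exists K, j'; split.
- apply: (injective_retract (i := i) (r := r)) iI => x.
  by apply: iI'; rewrite rE; exact: psiE.
- by move=> x y jxy; apply: jI; rewrite -!j'E jxy.
- move=> V hV jV0.
  have iV0 : i @` V = [set 0].
    apply: eE; first exact: submodule_image.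
      by move=> _ [x _ <-]; rewrite -ir; exists x.
    apply: meet_eq0 => //; first exact: submodule_image.
    move=> _ [x _ <-] [v Vv]; rewrite -j'E => /iI' vx.
    suff -> : j' x = 0 by rewrite linear0.
    by rewrite -[_ = 0]/([set 0] (j' x)) -jV0; split; [exists x|rewrite -vx].
  apply/seteqP; split=> [v Vv|_ ->]; last exact: sub0.
  apply: ((injectiveP _).1 iI').
  by rewrite -[_ = 0]/([set 0] (i v)) -iV0; exists v.
Qed.

Lemma IE_unique M Q Q' : is_IE M Q -> is_IE M Q' -> isomorphic Q Q'.
Proof.
move=> [i [iQ iI ie]] [i' [iQ' iI' ie']].
have [f fE] := iQ' _ _ i i' iI.
have fI : injective_map f.
  by apply: (essential_inj ie) => x y fxy; apply: iI'; rewrite -!fE.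
have [g gE] := iQ _ _ f idfun fI.
have gI : injective_map g.
  apply: (essential_inj ie') => x y; rewrite /= -!fE /= => gxy; apply: iI.
  by rewrite -[i x]/(idfun (i x)) -[i y]/(idfun (i y)) -!gE.
apply/isomorphicP; exists f; split=> //; apply/surjectiveP => y.
by exists (g y); apply: gI; exact: gE.
Qed.

End Injective.

(** * Enough injectives *)

Section DivisibleGroups.

Lemma int_principal (U : set int^o) : submodule U ->
  exists2 n : int^o, U n & forall a, U a -> exists b : int, a = b *: n.
Proof.
move=> hU; have [nz|z] := pselect (exists n : int^o, U n /\ n != 0); last first.
  exists 0; first exact: sub0.
  move=> a Ua; exists 0; rewrite scale0r; apply: contrapT => /eqP a0.
  by apply: z; exists a.
have [n [[Un n0] nmin]] := ex_argmin (fun n : int^o => `|n : int|%N) nz.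
exists n => // a Ua; exists (a %/ n)%Z; apply: contrapT => /eqP ne.
pose r : int^o := (a - (a %/ n)%Z *: n).
have Ur : U r by apply: subB => //; exact: subZ.
have rE : r = (a %% n)%Z.
  by rewrite /r [X in X - _](divz_eq a n) addrAC subrr add0r.
have := nmin r; rewrite rE leqNgt => /(_ _)/negP; apply; last first.
  by rewrite -ltz_nat gez0_abs ?modz_ge0 ?abszE ?ltz_mod.
by rewrite -rE; split => //; rewrite /r subr_eq0.
Qed.

Lemma additive_int_linear (X Y : lmodType int) (f : X -> Y) :
  {morph f : x y / x + y} -> linear f.
Proof.
move=> fD.
have f0 : f 0 = 0 by apply: (addrI (f 0)); rewrite -fD !addr0.
have fN x : f (- x) = - f x by apply: (addIr (f x)); rewrite -fD !addNr.
have fMn x n : f (x *+ n) = f x *+ n.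
  by elim: n => // n IHn; rewrite !mulrS fD IHn.
move=> a x y; rewrite fD; congr (_ + _).
rewrite -[a]intz !scaler_int; case: a => n; rewrite ?NegzE ?mulrNz ?fN.
  by rewrite -!pmulrn.
by rewrite -!pmulrn fMn.
Qed.

Definition divisible (D : lmodType int) :=
  forall (n : int) (d : D), n != 0 -> exists w, n *: w = d.

(** Zorn's lemma for graphs of partial extensions.  If y is not in the domain of
    a maximal one, the integers n with n y in the domain are the multiples of
    some n0; dividing the value of n0 y by n0 gives a possible value of y
    (any value will do if n0 = 0). *)
Lemma divisible_injective (D : lmodType int) :
  divisible D -> injective_module D.
Proof.
move=> dD X Y g f gI.
pose YD : lmodType int := (Y * D)%type.
pose good (G : set YD) := [/\ submodule G, forall d, G (0, d) -> d = 0 &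
  forall x, G (g x, f x)].
have lgf : linear (fun x => (g x, f x) : YD).
  by move=> a x y; apply/pair_equal_spec; rewrite !linearP.
have [||G [[hG G0 Gb] Gmax]] := @Zorn_nonempty YD good (range (lin lgf)).
- split; first exact: submodule_range.
    move=> d [x _ [gx <-]]; rewrite (_ : x = 0) ?linear0//.
    exact: ((injectiveP _).1 gI).
  by move=> x; exists x.
- move=> F [G0 FG0] FP tF; split.
  + by apply: submodule_chain => //; [exists G0|move=> G /FP[]].
  + by move=> d [G FG Gd]; have [_ + _] := FP _ FG; apply.
  + by move=> x; exists G0 => //; have [_ _] := FP _ FG0; apply.
have tot y : exists d, G (y, d).
  have hU : submodule [set n : int^o | exists d, G (n *: y, d)].
    apply/submoduleP; split=> [|a m n [d Gd] [d' Gd']].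
      by exists 0; rewrite scale0r; exact: (sub0 hG).
    exists (a *: d + d'); rewrite scalerDl -scalerA.
    by have := subD hG (subZ hG a Gd) Gd'.
  have [n0 [d0 Gd0] nU] := int_principal hU.
  have [w wd0] : exists w, n0 *: w = d0.
    have [n00|n00] := eqVneq (n0 : int) 0; last exact: dD.
    exists 0; rewrite scaler0; apply/esym/G0.
    by move: Gd0; rewrite n00 scale0r.
  pose G' := sum_set G (cyc ((y, w) : YD)).
  have hw := submodule_cyc ((y, w) : YD).
  have GG' : G `<=` G' by exact: sum_setl.
  suff -> : G = G'.
    have wG' : cyc ((y, w) : YD) `<=` G' by exact: sum_setr.
    by exists w; exact: (wG' _ (cyc_id _)).
  apply/esym/Gmax => //; split; first exact: submodule_sum.
    move=> d [[y' d'] Gy' [_ [n _ <-]]].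
    move=> e; have [y'E dE] : y' + n *: y = 0 /\ d' + n *: w = d.
      by move: e => [].
    have Gn : G (- n *: y, d') by rewrite scaleNr -(addr0_eq y'E) opprK.
    have [|b bE] := nU (- n); first by exists d'.
    have : G (0, d' + n *: w).
      have := subB hG Gn (subZ hG b Gd0).
      rewrite (_ : _ - _ = (- n *: y - b *: (n0 *: y), d' - b *: d0))//.
      rewrite !scalerA -[b * n0]/(b *: n0) -bE subrr -wd0 scalerA.
      by rewrite -[b * n0]/(b *: n0) -bE scaleNr opprK.
    by rewrite dE => /G0.
  by move=> x; exact: GG'.
pose h y := projT1 (cid (tot y)).
have hG' y : G (y, h y) by rewrite /h; case: cid.
have Gfun y d d' : G (y, d) -> G (y, d') -> d = d'.
  move=> Gd Gd'; apply/subr0_eq/G0; rewrite -(subrr y).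
  exact: (subB hG Gd Gd').
have lh : linear h.
  move=> a x y; apply: (Gfun (a *: x + y)); first exact: hG'.
  exact: (subD hG (subZ hG a (hG' x)) (hG' y)).
by exists (lin lh) => x /=; apply: (Gfun (g x)).
Qed.

(** In Q/Z the class of 1/n is killed by n; for n = 0 take that of 1/2. *)
Lemma circle_group : exists D : lmodType int, divisible D /\
  forall n : int, n != 1 -> n != - 1 -> exists2 c : D, c <> 0 & n *: c = 0.
Proof.
pose Q : lmodType int := zmodule rat.
have scQ (n : int) (x : Q) : n *: x = (x : rat) * n%:~R :> rat.
  by rewrite mulrzr.
have [D [q [/surjectiveP qS qk]]] := quotient_module (submodule_cyc (1 : Q)).
exists D; split.
  move=> n d n0; have [x <-] := qS d.
  exists (q ((x : rat) / n%:~R)); rewrite -linearZ; congr (q _).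
  by rewrite /= scQ divfK // intr_eq0.
move=> n n1 nN1.
have qc (c : Q) : (forall m : int, m%:~R != c :> rat) -> q c <> 0.
  move=> cZ; change (~ kernel q c); rewrite qk => -[m _ mc].
  by have /negP := cZ m; apply; apply/eqP; rewrite -mc /= scQ mul1r.
have [->|n0] := eqVneq n 0.
  exists (q (2^-1 : rat)); last exact: scale0r.
  apply: qc => m; apply/eqP => /(congr1 (fun x => x * 2)).
  rewrite mulVf // -[2]/(2%:~R) -intrM -[1]/(1%:~R) => /eqP; rewrite eqr_int.
  by move=> /eqP/(congr1 (fun n => odd `|n|%N)); rewrite abszM oddM andbF.
exists (q ((n%:~R)^-1 : rat)).
  apply: qc => m; apply/eqP => /(congr1 (fun x => x * n%:~R)).
  rewrite mulVf ?intr_eq0 // -intrM -[1]/(1%:~R) => /eqP; rewrite eqr_int.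
  move=> /eqP/(congr1 absz)/eqP; rewrite abszM muln_eq1 => /andP[_].
  by case: n n1 nN1 {n0} => [[|[|//]]|[|//]].
rewrite -linearZ; change (kernel q (n *: ((n%:~R)^-1 : Q))).
by rewrite qk; exists 1 => //=; rewrite !scQ mulVf ?intr_eq0 // mulr1.
Qed.

(** The subgroup generated by t is Z / n with n other than 1 and -1; map t to a
    nonzero element killed by n and extend by divisibility. *)
Lemma separating_character (D T : lmodType int) (t : T) :
  divisible D ->
  (forall n : int, n != 1 -> n != - 1 -> exists2 c : D, c <> 0 & n *: c = 0) ->
  t <> 0 -> exists chi : {linear T -> D}, chi t <> 0.
Proof.
move=> /divisible_injective iD cD t0.
have [ft ftE] := free_map t.
have [n nt nU] := int_principal (submodule_ker ft).
have {}nt : n *: t = 0 by rewrite -ftE.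
have [||c c0 nc] := cD n.
- by apply/eqP => n1; apply: t0; rewrite -nt n1 scale1r.
- by apply/eqP => n1; apply: t0; rewrite -[t]scale1r -[1]opprK scaleNr -n1 nt oppr0.
have [K [i [iI ir]]] := submodule_module (submodule_range ft).
have [th thE] : exists h : {linear int^o -> K}, forall x, i (h x) = ft x.
  by apply: lift_inj => // x; rewrite ir; exists x.
have thS : surjective_map th.
  apply/surjectiveP => x; have : range i (i x) by exists x.
  by rewrite ir => -[y _ yx]; exists y; apply: iI; rewrite thE.
have [fc fcE] := free_map c.
have [|h hE] := lift_surj (f := fc) thS.
  move=> x thx; have [|b ->] := nU x.
    by change (ft x = 0); rewrite -thE thx linear0.
  by rewrite fcE -scalerA nc scaler0.
have [chi chiE] := iD _ _ i h iI.
exists chi; have -> : t = i (th 1) by rewrite thE ftE scale1r.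
by have /= -> := chiE (th 1); rewrite hE fcE scale1r.
Qed.

End DivisibleGroups.

Section Coinduced.
Context (R : nzRingType) (D : lmodType int).

Definition additive_map : {pred R -> D} :=
  fun f => `[< {morph f : x y / x + y} >].

Lemma additive_map_zmod_closed : zmod_closed additive_map.
Proof.
split; first by apply/asboolP => x y /=; rewrite addr0.
move=> f g /asboolP fD /asboolP gD; apply/asboolP => x y.
by change (f (x + y) - g (x + y) = f x - g x + (f y - g y));
   rewrite fD gD opprD addrACA.
Qed.

HB.instance Definition _ := GRing.isZmodClosed.Build
  (R -> D) additive_map additive_map_zmod_closed.

(** The left module Hom_Z(R, D): (a f)(x) = f(x a). *)
Record coind := Coind { coind_fun :> R -> D; _ : coind_fun \in additive_map }.

HB.instance Definition _ := [isSub for coind_fun].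
HB.instance Definition _ := [Choice of coind by <:].
HB.instance Definition _ := [SubChoice_isSubZmodule of coind by <:].

Lemma coindD (f : coind) x y : f (x + y) = f x + f y.
Proof. by case: f => f /= /asboolP. Qed.

Lemma coind_scale_subproof a (f : coind) :
  (fun x => f (x * a)) \in additive_map.
Proof. by apply/asboolP => x y /=; rewrite mulrDl coindD. Qed.

Definition coind_scale a (f : coind) := Coind (coind_scale_subproof a f).

Lemma coind_scaleA a b f :
  coind_scale a (coind_scale b f) = coind_scale (a * b) f.
Proof. by apply: val_inj; apply/funext => x /=; rewrite mulrA. Qed.

Lemma coind_scale1 : left_id 1 coind_scale.
Proof. by move=> f; apply: val_inj; apply/funext => x /=; rewrite mulr1. Qed.

Lemma coind_scaleDr : right_distributive coind_scale +%R.
Proof. by move=> a f g; apply: val_inj. Qed.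

Lemma coind_scaleDl f : {morph coind_scale^~ f : a b / a + b}.
Proof.
move=> a b; apply: val_inj; apply/funext => x /=.
by rewrite mulrDr coindD.
Qed.

HB.instance Definition _ := GRing.Zmodule_isLmodule.Build R coind
  coind_scaleA coind_scale1 coind_scaleDr coind_scaleDl.

(** R-linear maps into the coinduced module are additive maps into D, by
    evaluation at 1. *)
Lemma coind_injective : divisible D -> injective_module (coind : lmodType R).
Proof.
move=> /divisible_injective iD X Y g f gI.
have lg : linear (g : zmodule X -> zmodule Y).
  by apply: additive_int_linear => x y; exact: (raddfD g).
have lf1 : linear (fun x : zmodule X => (f x : coind) 1).
  by apply: additive_int_linear => x y; rewrite (raddfD f).
have [F FE] := iD _ _ (lin lg) (lin lf1) gI.
have Fy_subproof (y : Y) : (fun c : R => F (c *: y)) \in additive_map.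
  by apply/asboolP => c c'; rewrite scalerDl (raddfD F).
pose h y := Coind (Fy_subproof y).
have lh : linear h.
  move=> a y y'; apply: val_inj; apply/funext => c /=.
  change (F (c *: (a *: y + y')) = F ((c * a) *: y) + F (c *: y')).
  by rewrite scalerDr scalerA (raddfD F).
exists (lin lh) => x; apply: val_inj; apply/funext => c /=.
rewrite -linearZ; have /= -> := FE (c *: x).
rewrite linearZ /= -[LHS]/((f x : coind) (1 * c)).
by rewrite mul1r.
Qed.

End Coinduced.

Section EnoughInjectives.
Context {R : nzRingType}.

(** The characters chi s, one for each s in M and nonzero at s, embed M into the
    coinduced module of a power of Q/Z. *)
Lemma IE_exists (M : lmodType R) : exists Q, is_IE M Q.
Proof.
have [C [dC cC]] := circle_group.
pose D : lmodType int := M -> C.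
have dD : divisible D.
  move=> n d n0; have [w wd] := choice (fun x => dC n (d x) n0).
  by exists w; apply/funext => x; exact: wd.
have chi_ex (s : M) : exists chi : {linear zmodule M -> C},
    s <> 0 -> chi s <> 0.
  have [->|/eqP s0] := eqVneq s 0.
    have l0 : linear (fun _ : zmodule M => 0 : C).
      by move=> a x y; rewrite scaler0 addr0.
    by exists (lin l0).
  by have [chi chis] := @separating_character C (zmodule M) s dC cC s0; exists chi.
have [chi chiE] := choice chi_ex.
have e_subproof (x : M) : (fun c : R => (fun s => chi s (c *: x)) : D)
    \in @additive_map R D.
  apply/asboolP => c c'; apply/funext => s.
  by rewrite scalerDl (raddfD (chi s)).
pose e x : coind R D := Coind (e_subproof x).
have le : linear e.
  move=> a x y; apply: val_inj; apply/funext => c; apply/funext => s /=.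
  change (chi s (c *: (a *: x + y)) = chi s ((c * a) *: x) + chi s (c *: y)).
  by rewrite scalerDr scalerA (raddfD (chi s)).
apply: (injective_envelope_exists (I := coind R D) (j := lin le)).
  exact: coind_injective.
apply/injectiveP => x ex0; apply: contrapT => /chiE; apply.
have : (e x : coind R D) 1 x = 0 by rewrite -[e x]/(lin le x) ex0.
by rewrite /= scale1r.
Qed.

End EnoughInjectives.

(** * Artinian rings and the uniserial summands of the regular module *)

Section ArtinianModules.
Context {R : nzRingType}.
Implicit Types M : lmodType R.

Definition artinian_below M (W : set M) := forall U : nat -> set M,
  (forall n, submodule (U n)) -> (forall n, U n `<=` W) ->
  (forall n, U n.+1 `<=` U n) ->
  exists n, forall m, (n <= m)%N -> U m = U n.

Lemma descending_le M (U : nat -> set M) : (forall n, U n.+1 `<=` U n) ->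
  forall m n, (m <= n)%N -> U n `<=` U m.
Proof.
move=> dU m; elim=> [|n IHn]; first by rewrite leqn0 => /eqP ->.
rewrite leq_eqVlt => /orP[/eqP -> //|mn].
exact: subset_trans (dU n) (IHn mn).
Qed.

(** A submodule U of W + R v is determined, within a chain, by its intersection
    with W and by the ideal of the c with c v in U + W. *)
Lemma artinian_below_add M (W : set M) (v : M) :
  artinian_module (R^o : lmodType R) -> submodule W ->
  artinian_below W -> artinian_below (sum_set W (cyc v)).
Proof.
move=> aR hW aW U hU UW dU.
(* the coefficients of v in the elements of U n + W *)
pose I n := [set c : R^o | exists2 w, W w & U n (c *: v + w)].
have hI n : submodule (I n).
  apply/submoduleP; split=> [|c a b [w Ww Uw] [w' Ww' Uw']].
    exists 0; first exact: sub0.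
    by rewrite scale0r addr0; exact: sub0 (hU n).
  exists (c *: w + w'); first by apply: subD => //; exact: subZ.
  have := subD (hU n) (subZ (hU n) c Uw) Uw'.
  by rewrite scalerDr scalerA addrACA scalerDl.
have [||| n1 n1P] := aW (fun n => U n `&` W).
- by move=> n; exact: submoduleI.
- by move=> n x [].
- by move=> n x [Ux Wx]; split=> //; exact: dU.
have [|n2 n2P] := aR I hI.
  by move=> n c [w Ww Uw]; exists w => //; exact: dU.
exists (maxn n1 n2) => m; rewrite geq_max => /andP[n1m n2m].
have leU := descending_le dU.
apply/seteqP; split; first by apply: leU; rewrite geq_max n1m n2m.
move=> x Ux; have [w Ww [_ [c _ <-] xE]] := UW _ _ Ux.
have Ic : I m c.
  rewrite (n2P m n2m) -(n2P (maxn n1 n2) (leq_maxr _ _)).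
  by exists w => //; rewrite addrC xE.
have [w' Ww' Uw'] := Ic.
have Uw'x : U (maxn n1 n2) (c *: v + w').
  by apply: leU Uw'; rewrite geq_max n1m n2m.
have : (U m `&` W) (w - w').
  rewrite (n1P m n1m) -(n1P (maxn n1 n2) (leq_maxl _ _)); split.
    have := subB (hU _) Ux Uw'x.
    by rewrite -xE [c *: v + w']addrC opprD addrACA subrr addr0.
  exact: subB.
move=> [Uww' _]; have := subD (hU m) Uww' Uw'.
by rewrite -xE [c *: v + w']addrC addrA subrK.
Qed.

Lemma fin_gen_artinian M : artinian_module (R^o : lmodType R) -> fin_gen M ->
  artinian_below [set: M].
Proof.
move=> aR [n [v vT]].
pose span j := [set x : M | exists a : nat -> R,
  x = \sum_(i < j) a i *: (if insub (i : nat) is Some i' then v i' else 0)].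
have hspan j : submodule (span j).
  apply/submoduleP; split.
    by exists (fun=> 0); rewrite big1 // => i _; rewrite scale0r.
  move=> c _ _ [a ->] [b ->]; exists (fun i => c * a i + b i).
  rewrite scaler_sumr -big_split /=; apply: eq_bigr => i _.
  by rewrite scalerDl scalerA.
have aspan j : artinian_below (span j).
  elim: j => [|j IHj].
    move=> U hU U0 _; exists 0%N => m _; apply/seteqP; split=> x /[dup] Ux /U0[a].
      by rewrite big_ord0 => ->; exact: sub0.
    by rewrite big_ord0 => ->; exact: sub0.
  pose u : M := if insub j is Some i' then v i' else 0.
  move=> U hU Uj dU.
  apply: (artinian_below_add (v := u) aR (hspan j) IHj) => // m x Ux.
  have [a ->] := Uj m x Ux.
  rewrite big_ord_recr /=; exists (\sum_(i < j) a i *: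
    (if insub (i : nat) is Some i' then v i' else 0)); first by exists a.
  by exists (a j *: u) => //; exists (a j).
move=> U hU _ dU; apply: (aspan n) => // m x _.
have [a ->] := vT x.
exists (fun i => if insub i is Some i' then a i' else 0).
by apply: eq_bigr => i _; rewrite valK.
Qed.

Lemma artinian_minimal M (P : set M -> Prop) : artinian_module M ->
  (forall U, P U -> submodule U) -> (exists U, P U) ->
  exists U, P U /\ forall V, P V -> V `<=` U -> V = U.
Proof.
move=> aM hP [U0 PU0]; apply: contrapT => nmin.
have next (U : {U | P U}) : exists V : {V | P V}, sval V `<` sval U.
  case: U => U PU /=; apply: contrapT => nV; apply: nmin; exists U; split=> //.
  move=> V PV VU; apply: contrapT => VU'; apply: nV; exists (exist _ V PV).
  by split=> //= UV; apply: VU'; apply/seteqP.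
have [f fP] := choice next.
pose s n := iter n f (exist _ U0 PU0).
have [n nP] := aM (fun n => sval (s n)) (fun n => hP _ (svalP (s n)))
  (fun n => (fP (s n)).1).
have [_] := fP (s n); apply.
by have /= -> := nP n.+1 (leqnSn n).
Qed.

End ArtinianModules.

Lemma artin_algebra_artinian (k : comNzRingType) (A : algType k) :
  artin_algebra A -> artinian_module (A^o : lmodType A).
Proof.
move=> [ak fA] U hU dU.
apply: (fin_gen_artinian ak fA) => // n; apply/submoduleP; split.
  exact: (sub0 (hU n)).
move=> c u v Uu Uv; apply: (subD (hU n)) => //.
have -> : c *: (u : A) = (c%:A : A) * u by rewrite -scalerAl mul1r.
exact: (subZ (hU n) (c%:A : A) Uu).
Qed.

Section ArtinianSerialRing.
Context {R : nzRingType}.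
Hypothesis artR : artinian_module (R^o : lmodType R).
Hypothesis hN : forall M : lmodType R, fin_gen M -> indecomposable M -> serial M.
Implicit Types M P Q S : lmodType R.

(** If R e is the direct sum of U and V and e = u + v accordingly, then u is an
    idempotent that generates U.  The ideal R e is presented by an injection i,
    so that U and V are submodules of a module in its own right. *)
Lemma idempotent_component (e : R) (K : lmodType R) (i : {linear K -> R^o})
    (U V : set K) (u v y : K) :
  e * e = e -> injective_map i -> range i = cyc (e : R^o) -> i y = e ->
  submodule U -> submodule V -> U `&` V = [set 0] -> V <> [set 0] ->
  y = u + v -> U u -> V v ->
  (i u : R) * i u = i u /\ cyc (i u) `<` cyc (e : R^o).
Proof.
move=> ee iI ir iy hU hV UV0 V0 yE Uu Vv.
have iZ a x : i (a *: x) = a * i x :> R by rewrite linearZ.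
have ye x : i x *: y = x.
  apply: iI; rewrite iZ iy; have : cyc (e : R^o) (i x) by rewrite -ir; exists x.
  by move=> [b _ <-]; rewrite -[LHS]/(b * e * e) -mulrA ee.
have uu : i u *: u = u.
  have : (U `&` V) (u - i u *: u).
    split; first by apply: subB => //; exact: subZ.
    rewrite -{1}[u]ye yE scalerDr addrAC subrr add0r; exact: subZ.
  by rewrite UV0 => /subr0_eq/esym.
split; first by rewrite -iZ uu.
have iuT : cyc (i u) `<=` cyc (e : R^o).
  by apply: cyc_sub; [exact: submodule_cyc|rewrite -ir; exists u].
split=> // ecyc; apply: V0; apply/seteqP; split=> [x Vx|_ ->]; last exact: sub0.
have [c _ ce] := ecyc _ (cyc_id _).
have yu : y = c *: u by apply: iI; rewrite iZ iy.
rewrite -UV0; split=> //; rewrite -[x]ye yu scalerA; exact: subZ.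
Qed.

(** The ring is a finite sum of uniserial left ideals R e with e idempotent.  A
    statement that is additive in e can be checked on those summands: otherwise
    take R e minimal among the counterexamples; it is not uniserial, hence
    decomposes, and a component of e is a smaller counterexample. *)
Lemma idempotent_ind (Phi : R -> Prop) :
  (forall (e : R) (K : lmodType R) (i : {linear K -> R^o}), e * e = e ->
     injective_map i -> range i = cyc (e : R^o) -> uniserial K -> Phi e) ->
  (forall e f, Phi e -> Phi f -> Phi (e + f)) -> Phi 1.
Proof.
move=> uPhi addPhi; apply: contrapT => nPhi1.
have [||U [[e [ee -> nPhie]] emin]] := artinian_minimal (P := fun U : set R^o =>
    exists e : R, [/\ e * e = e, U = cyc (e : R^o) & ~ Phi e]) artR.
- by move=> _ [e [_ -> _]]; exact: submodule_cyc.
- by exists (cyc (1 : R^o)), 1; split=> //; exact: mulr1.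
have Phi_lt f : f * f = f -> cyc (f : R^o) `<` cyc (e : R^o) -> Phi f.
  move=> ff [fe ef]; apply: contrapT => nPhif; apply: ef.
  by rewrite -(emin (cyc (f : R^o))) //; exists f.
have [K [i [iI ir]]] := submodule_module (submodule_cyc (e : R^o)).
have [y iy] : exists y, i y = e.
  have : range i e by rewrite ir; exact: cyc_id.
  by move=> [y _ <-]; exists y.
apply/nPhie/(uPhi e K i) => //.
have yT : cyc y = setT.
  apply: subsetT_eq => x _; have : range i (i x) by exists x.
  rewrite ir => -[b _ be]; exists b => //; apply: iI.
  by rewrite linearZ iy.
apply: (fin_gen_uniserial hN); first exact: cyclic_fin_gen yT.
move=> /nontrivialP K0; split=> // U' V hU hV UV UV0.
have [|U0] := pselect (U' = [set 0]); first by left.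
have [|V0] := pselect (V = [set 0]); first by right.
exfalso; apply: nPhie.
have : [set: K] y by [].
rewrite -UV => -[u Uu [v Vv /esym yE]].
have [uu ltu] := idempotent_component ee iI ir iy hU hV UV0 V0 yE Uu Vv.
rewrite setIC in UV0; rewrite addrC in yE.
have [vv ltv] := idempotent_component ee iI ir iy hV hU UV0 U0 yE Vv Uu.
by rewrite -iy yE linearD; apply: addPhi; exact: Phi_lt.
Qed.

Lemma projective_left_ideal (e : R) (K : lmodType R) (i : {linear K -> R^o}) :
  e * e = e -> injective_map i -> range i = cyc (e : R^o) -> projective K.
Proof.
move=> ee iI ir; have [fe feE] := free_map (e : R^o).
have [r rE] : exists r : {linear R^o -> K}, forall x, i (r x) = fe x.
  by apply: lift_inj => // x; rewrite feE ir; exists x.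
apply: (projective_retract (i := i) (r := r)) (projective_free) => x.
apply: iI; rewrite rE feE.
have : range i (i x) by exists x.
by rewrite ir => -[b _ <-]; rewrite -[LHS]/(b * e * e) -mulrA ee.
Qed.

(** M is generated by x, and x = 1 x is not in the largest proper submodule, so
    neither is e x for some uniserial summand R e; that summand covers M. *)
Lemma PC_exists M : uniserial M -> nontrivial M -> exists P, is_PC M P.
Proof.
move=> uM M0; have [m lm] := uniserial_local uM M0; have [hm mT mv] := lm.
have [x xT] := uniserial_cyclic uM.
suff [|//] : m (1 *: x) \/ exists P, is_PC M P.
  rewrite scale1r => mx; case: mT; apply: subsetT_eq; rewrite -xT.
  exact: cyc_sub.
apply: (idempotent_ind (Phi := fun e => m (e *: x) \/ _)); last first.
  move=> e f [me|]; last by right.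
  move=> [mf|]; last by right.
  by left; rewrite scalerDl; exact: subD.
move=> e K i ee iI ir uK; have [|mex] := pselect (m (e *: x)); first by left.
right; exists K; have [fx fxE] := free_map x.
have pS : surjective_map (fx \o i).
  apply/surjectiveP => y; have : [set: M] y by [].
  rewrite -(mv _ mex) => -[b _ <-].
  have : range i (b * e) by rewrite ir; exists b.
  by move=> [z _ iz]; exists z; rewrite /= iz fxE scalerA.
exists (fx \o i); split=> //; first exact: projective_left_ideal ir.
apply: (chain_superfluous uK.1); first exact: submodule_ker.
move=> kT; have [y y0] := M0; apply: y0.
have [z <-] := (surjectiveP _).1 pS y.
by change (kernel (fx \o i) z); rewrite kT.
Qed.

Lemma syzygy_exists M : uniserial M -> nontrivial M -> exists K, is_syzygy M K.
Proof. by move=> uM M0; have [P /PC_syzygy] := PC_exists uM M0. Qed.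

(** In a chain module the largest of the submodules R e y, with R e a summand of
    R, contains y; hence the rank is bounded by that of the R e. *)
Lemma cyclic_rank_bound : exists L, forall Y : lmodType R, chain_module Y ->
  forall y : Y, ranked (cyc y) L.
Proof.
suff : exists L, forall Y : lmodType R, chain_module Y ->
    forall y : Y, ranked (cyc (1 *: y)) L.
  by move=> [L LP]; exists L => Y cY y; have := LP Y cY y; rewrite scale1r.
apply: (idempotent_ind (Phi := fun e => exists L, forall Y : lmodType R,
  chain_module Y -> forall y : Y, ranked (cyc (e *: y)) L)).
  move=> e K i _ iI ir [_ [L rK]]; exists L => Y cY y.
  have [fy fyE] := free_map y.
  have := ranked_surj (fy \o i) (@submoduleT _ _) rK.
  rewrite (_ : [set (fy \o i) x | x in setT] = cyc (e *: y)) //.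
  apply/seteqP; split=> [_ [x _ <-]|_ [b _ <-]].
    have : range i (i x) by exists x.
    by rewrite ir => -[b _ be]; exists b => //=; rewrite fyE -be scalerA.
  have : range i (b * e) by rewrite ir; exists b.
  by move=> [x _ xb]; exists x => //=; rewrite xb fyE scalerA.
move=> e f [L LP] [L' LP']; exists (L + L')%N => Y cY y.
have [ef|fe] := cY _ _ (submodule_cyc (e *: y)) (submodule_cyc (f *: y)).
  apply: ranked_sub (LP' Y cY y); last exact: leq_addl.
  apply: cyc_sub; first exact: submodule_cyc.
  rewrite scalerDl; apply: (subD (submodule_cyc _)); last exact: cyc_id.
  exact/ef/cyc_id.
apply: ranked_sub (LP Y cY y); last exact: leq_addr.
apply: cyc_sub; first exact: submodule_cyc.
rewrite scalerDl; apply: (subD (submodule_cyc _)); first exact: cyc_id.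
exact/fe/cyc_id.
Qed.

(** The nonzero finitely generated submodules of the envelope contain S, so they
    are indecomposable, hence uniserial.  Their rank is bounded, so the
    longest one is the whole envelope. *)
Lemma IE_uniserial S Q : simple_module S -> is_IE S Q -> uniserial Q.
Proof.
move=> sS [j [iQ jI ej]].
have [s s0] := simple_nontrivial sS.
have js0 : j s <> 0 by move=> /((injectiveP _).1 jI).
have socQ (V : set Q) : submodule V -> V <> [set 0] -> V (j s).
  move=> hV V0; apply: contrapT => Vjs; apply: V0; apply: ej => //.
  apply/seteqP; split=> [_ [[x _ <-] Vx]|_ ->]; last first.
    by split; [exact: sub0 (submodule_range j)|exact: sub0].
  have [U0|UT] := simple_submodules sS (submodule_preim j hV).
    suff -> : x = 0 by rewrite linear0.
    by change ([set 0] x); rewrite -U0.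
  by case: Vjs; change ((j @^-1` V) s); rewrite UT.
have cQ : chain_module Q.
  move=> V W hV hW; apply: contrapT => /not_orP[].
  move=> /not_subset[v Vv Wv] /not_subset[w Ww Vw].
  have [K [i [iI ir]]] := submodule_module
    (submodule_sum (submodule_cyc v) (submodule_cyc w)).
  have [v' iv] : exists v', i v' = v.
    have : range i v.
      by rewrite ir; apply: (sum_setl (submodule_cyc _)); exact: cyc_id.
    by move=> [x _ <-]; exists x.
  have [w' iw] : exists w', i w' = w.
    have : range i w.
      by rewrite ir; apply: (sum_setr (submodule_cyc _)); exact: cyc_id.
    by move=> [x _ <-]; exists x.
  have uK : uniserial K.
    apply: (fin_gen_uniserial hN).
      exists 2%N, (fun n : 'I_2 => if n == 0 then v' else w') => x.
      have : range i (i x) by exists x.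
      rewrite ir => -[_ [a _ <-] [_ [b _ <-] xE]].
      exists (fun n : 'I_2 => if n == 0 then a else b).
      rewrite big_ord_recl big_ord1 /=; apply: iI.
      by rewrite linearD !linearZ /= iv iw xE.
    move=> /nontrivialP K0; split=> // U U' hU hU' _ UU0.
    have [|U0] := pselect (U = [set 0]); first by left.
    have [|U0'] := pselect (U' = [set 0]); first by right.
    have im0 (X : set K) : submodule X -> X <> [set 0] -> (i @` X) (j s).
      move=> hX /(zero_neq hX)[x Xx x0]; apply: socQ.
        exact: submodule_image.
      move=> e; apply: x0; apply: ((injectiveP _).1 iI).
      by rewrite -[_ = 0]/([set 0] (i x)) -e; exists x.
    have [x Ux xs] := im0 _ hU U0; have [x' Ux' xs'] := im0 _ hU' U0'.
    case: js0; rewrite -xs; suff -> : x = 0 by rewrite linear0.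
    by change ([set 0] x); rewrite -UU0; split=> //; rewrite (iI x x') // xs.
  have [vw|wv] := uK.1 _ _ (submodule_cyc v') (submodule_cyc w').
    have [b _ bv] := vw _ (cyc_id _).
    by apply: Wv; rewrite -iv -bv linearZ /= iw; exact: subZ.
  have [b _ bw] := wv _ (cyc_id _).
  by apply: Vw; rewrite -iw -bw linearZ /= iv; exact: subZ.
split=> //; have [L LP] := cyclic_rank_bound; exists L.
suff [q qT] : exists q : Q, cyc q = setT by rewrite -qT; exact: LP.
apply: contrapT => nq.
(* a generator of rank > L, by repeatedly adjoining an element *)
suff /(_ L.+1)[q qL] : forall n, exists q : Q, forall r : set Q -> nat,
    (forall U V, submodule U -> submodule V -> U `<` V -> V `<=` cyc q ->
       (r U < r V)%N) -> (n <= r (cyc q))%N.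
  have [r [r1 r2]] := LP Q cQ q.
  have := qL r r1; rewrite leqNgt ltnS r2 //; exact: submodule_cyc.
elim=> [|n [q qn]]; first by exists 0.
have [x xq] : exists x, ~ cyc q x.
  have [|x _ xq] := @not_subset _ setT (cyc q); last by exists x.
  by move=> /subsetT_eq qT; apply: nq; exists q.
have qx : cyc q `<` cyc x.
  have [qx|xq'] := cQ _ _ (submodule_cyc q) (submodule_cyc x).
    by split=> // xq'; apply/xq/xq'/cyc_id.
  by case: xq; apply/xq'/cyc_id.
exists x => r r1; apply: leq_ltn_trans (r1 _ _ _ _ qx _) => //;
  try exact: submodule_cyc.
apply: qn => U V hU hV UV Vq; apply: r1 => //.
exact: subset_trans Vq qx.1.
Qed.

End ArtinianSerialRing.

(** * The transpose of a simple module *)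

Section Transpose.
Context {R : nzRingType}.
Implicit Types P Q : lmodType R.

Lemma star_linear P (f : star P) : linear (f : P -> R^o).
Proof. by case: f => f /= /asboolP. Qed.

Lemma star_intro P (f : {linear P -> R^o}) :
  exists g : star P, forall x, (g : P -> R^o) x = f x.
Proof.
have fP : (f : P -> (R^c)^o) \in is_form (P := P).
  by apply/asboolP => c x y; exact: (linearP f).
by exists (Star fP).
Qed.

Lemma star_ext P (f g : star P) :
  (forall x, (f : P -> R^o) x = (g : P -> R^o) x) -> f = g.
Proof. by move=> fg; apply: val_inj; apply/funext. Qed.

Lemma star_scaleE P (b : R) (f : star P) (x : P) :
  ((conv b *: f : star P) : P -> R^o) x = ((f : P -> R^o) x : R) * b.
Proof. by []. Qed.

Lemma star_map_linear P Q (d : {linear P -> Q}) : linear (star_map d).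
Proof. by move=> c f g; apply: star_ext. Qed.

End Transpose.

Section TransposeOfSimple.
Context {R : nzRingType}.
Hypothesis artR : artinian_module (R^o : lmodType R).
Hypothesis hN : forall M : lmodType R, fin_gen M -> indecomposable M -> serial M.
Context {P0 P1 : lmodType R} (a : {linear P1 -> P0}).
Hypotheses (pP0 : projective P0) (pP1 : projective P1) (uP1 : uniserial P1)
  (la : local_at (range a)) (a_neq0 : exists u, a u <> 0).

(** Check this on the summands R e of R: if x |-> g(x) e is not zero and is onto
    the uniserial projective R e, it splits and is then an isomorphism,
    as P1 is uniserial; otherwise it factors through a. *)
Lemma form_split_or_factor (g : star P1) :
  (exists h : {linear R^o -> P1}, forall x, h ((g : P1 -> R^o) x) = x) \/
  range (star_map a) g.
Proof.
have P1n : nontrivial P1.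
  by have [u au] := a_neq0; exists u => u0; apply: au; rewrite u0 linear0.
have [m1 lm1] := uniserial_local uP1 P1n.
pose gl := lin (star_linear g).
suff [|[h hE]] : (exists h : {linear R^o -> P1}, forall x, h (gl x) = x) \/
    (exists h : {linear P0 -> R^o}, forall x, (gl x : R) * 1 = h (a x)).
- by left.
- right; have [h' h'E] := star_intro h; exists h' => //; apply: star_ext => x.
  rewrite -[RHS](mulr1 (gl x : R)); exact: (etrans (h'E (a x)) (esym (hE x))).
apply: (idempotent_ind artR hN (Phi := fun e => _ \/
  exists h : {linear P0 -> R^o}, forall x, (gl x : R) * e = h (a x))); last first.
  move=> e f [|[h hE]]; first by left.
  move=> [|[h' h'E]]; first by left.
  have lh : linear (fun x => h x + h' x).
    by move=> c x y; rewrite (linearP h) (linearP h') addrACA scalerDr.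
  by right; exists (lin lh) => x; rewrite mulrDr hE h'E.
move=> e K i ee iI ir uK.
have [fe feE] := free_map (e : R^o).
have [r rE] : exists r : {linear R^o -> K}, forall x, i (r x) = fe x.
  by apply: lift_inj => // x; rewrite feE ir; exists x.
pose ge : {linear P1 -> K} := r \o gl.
have geE x : i (ge x) = (gl x : R) * e by rewrite /ge /= rE feE.
have [geS|geS] := pselect (surjective_map ge); last first.
  have [h hE] := factor_through hN pP0 uK lm1 la a_neq0 geS.
  by right; exists (i \o h) => x; rewrite -geE; exact: (congr1 i (hE x)).
have [ge0|ge0] := pselect (forall x, ge x = 0).
  have l0 : linear (fun _ : P0 => 0 : R^o) by move=> c x y; rewrite scaler0 addr0.
  by right; exists (lin l0) => x; rewrite -geE ge0 linear0.
left; have [th thE] := projective_split (projective_left_ideal ee iI ir) geS.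
exists (th \o r) => x; rewrite -[LHS]/(th (ge x)).
have geI : injective_map ge.
  apply/injectiveP => y gey.
  have [tk|kt] := uP1.1 _ _ (submodule_range th) (submodule_ker ge).
    case: ge0 => z; rewrite -[ge z]thE.
    by change (kernel ge (th (ge z))); apply: tk; exists (ge z).
  have [z _ zy] := kt y gey.
  by move: gey; rewrite -zy thE => ->; rewrite linear0.
by apply: geI; rewrite thE.
Qed.

Context (X : lmodType R^c) (q : {linear star P1 -> X}).
Hypotheses (qS : surjective_map q) (qk : kernel q = range (star_map a)).

(** A form outside the image of a^* is a split embedding of P1 into R, and every
    form on P1 extends along it to a right multiplication of R. *)
Lemma transpose_simple (xi xi' : X) : xi <> 0 -> exists b : R, xi' = conv b *: xi.
Proof.
have [g <-] := (surjectiveP _).1 qS xi; have [g' <-] := (surjectiveP _).1 qS xi'.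
move=> qg; have [[h hE]|gr] := form_split_or_factor g; last first.
  by case: qg; change (kernel q g); rewrite qk.
exists ((g' : P1 -> R^o) (h 1)); rewrite -linearZ; congr (q _).
apply: star_ext => x; rewrite star_scaleE -{1}(hE x).
pose g'l := lin (star_linear g').
pose y : R := star_fun g x.
have yE : (y : R^o) = y *: (1 : R^o) by exact: esym (mulr1 y).
change (g'l (h (y : R^o)) = y *: g'l (h 1)).
by rewrite {1}yE !linearZ.
Qed.

(** A splitting s of R -> P1 is a form.  If it factored through a, then a would
    be a split injection, although its range is the largest proper submodule of
    the indecomposable module P0. *)
Lemma transpose_generator : exists (s : {linear P1 -> R^o}) (g : star P1) (u : P1),
  [/\ forall x, (g : P1 -> R^o) x = s x, forall x, x = (s x : R) *: u & q g <> 0].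
Proof.
have [u0 u0T] := uniserial_cyclic uP1.
have [f fE] := free_map u0.
have [|s sE] := projective_split (p := f) pP1.
  apply/surjectiveP => x; have : [set: P1] x by [].
  by rewrite -u0T => -[b _ <-]; exists b.
have [g gE] := star_intro s; exists s, g, u0; split=> //.
  by move=> x; rewrite -fE sE.
change (~ kernel q g); rewrite qk => -[h _ hE].
pose hl := lin (star_linear h).
(* rho is a retraction of a *)
pose rho : {linear P0 -> P1} := f \o hl.
have rhoE x : rho (a x) = x.
  by rewrite /rho /= -[RHS]sE -gE -hE.
have [u au] := a_neq0.
have ka : kernel rho `<=` range a.
  apply: local_sub => //; first exact: submodule_ker.
  move=> kT; apply: au; rewrite -[u]rhoE.
  suff -> : rho (a u) = 0 by rewrite linear0.
  by change (kernel rho (a u)); rewrite kT.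
have [y] := local_point la; apply.
apply: (subDr (submodule_range a) (v := - a (rho y))).
  by apply: subN; [exact: submodule_range|exists (rho y)].
by apply: ka; change (rho (y - a (rho y)) = 0); rewrite (linearB rho) rhoE subrr.
Qed.

End TransposeOfSimple.

(** * The dual of a simple right module *)

Section DualOfSimple.
Context {k : comNzRingType} {A : algType k}.
Hypothesis hA : artin_algebra A.
Context (X : lmodType A^c) (xi0 : X).
Hypothesis xi0_neq0 : xi0 <> 0.
Hypothesis X_simple :
  forall xi xi' : X, xi <> 0 -> exists b : A, xi' = conv b *: xi.

(** X over k; it is a vector space over k / m, where m is its annihilator. *)
Definition kmodule := (X : Type).
HB.instance Definition _ := GRing.Zmodule.on kmodule.

Definition kmodule_scale (c : k) (x : kmodule) : kmodule :=
  conv (c%:A : A) *: (x : X).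

Lemma convM (a b : A) (x : X) : conv a *: (conv b *: x) = conv (b * a) *: x.
Proof. by rewrite scalerA. Qed.

Lemma conv_central (c : k) (b : A) : (c%:A : A) * b = b * c%:A.
Proof. by rewrite -scalerAl -scalerAr mul1r mulr1. Qed.

Lemma kmodule_scaleA c d x :
  kmodule_scale c (kmodule_scale d x) = kmodule_scale (c * d) x.
Proof.
by rewrite /kmodule_scale convM -conv_central -scalerAl mul1r scalerA.
Qed.

Lemma kmodule_scale1 : left_id 1 kmodule_scale.
Proof. by move=> x; rewrite /kmodule_scale scale1r; exact: scale1r. Qed.

Lemma kmodule_scaleDr : right_distributive kmodule_scale +%R.
Proof. by move=> c x y; exact: scalerDr. Qed.

Lemma kmodule_scaleDl x : {morph kmodule_scale^~ x : c d / c + d}.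
Proof. by move=> c d; rewrite /kmodule_scale scalerDl; exact: scalerDl. Qed.

HB.instance Definition _ := GRing.Zmodule_isLmodule.Build k kmodule
  kmodule_scaleA kmodule_scale1 kmodule_scaleDr kmodule_scaleDl.

Let Xk : lmodType k := kmodule.

Lemma kscale_conv (c : k) (b : A) (x : X) :
  (c *: (conv b *: x : Xk) : Xk) = conv b *: (c *: (x : Xk) : Xk).
Proof.
change (conv (c%:A : A) *: (conv b *: x) = conv b *: (conv (c%:A : A) *: x)).
by rewrite !convM conv_central.
Qed.

Definition annihilator : set k^o := [set c | forall x : Xk, (c : k) *: x = 0].
Local Notation m := annihilator.

Lemma submodule_annihilator : submodule m.
Proof.
apply/submoduleP; split=> [x|a c d cm dm x]; first exact: scale0r.
by rewrite scalerDl dm addr0 -scalerA cm scaler0.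
Qed.

Lemma annihilator_test (c : k) (x : Xk) : x <> 0 -> c *: x = 0 -> m c.
Proof.
move=> x0 cx y; have [b ->] := X_simple y x0.
by rewrite kscale_conv cx scaler0.
Qed.

Lemma annihilator_prime (c d : k) : m (c * d) -> ~ m d -> m c.
Proof.
move=> cd /existsNP[x dx]; apply: (annihilator_test dx).
by rewrite scalerA; exact: cd.
Qed.

(** Take I minimal among the ideals of k not contained in the annihilator, and b
    in I outside it.  If c is outside too, then so is c b, which generates I by
    minimality.  Hence b lies in all maximal ideals other than the annihilator. *)
Lemma annihilator_separator : exists b : k, ~ m b /\
  forall c : k, ~ m c -> exists d, b = d * (c * b).
Proof.
have hm := submodule_annihilator.
have [||I [[hI Im] Imin]] := artinian_minimal (P := fun I : set k^o =>
    submodule I /\ ~ I `<=` m) hA.1.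
- by move=> I [].
- exists setT; split; first exact: submoduleT.
  by move=> /(_ 1 Logic.I)/(_ xi0); rewrite scale1r.
have /not_subset[b Ib mb] := Im.
exists b; split=> // c mc.
have mcb : ~ m (c * b : k) by move=> /annihilator_prime/(_ mb).
have Icb : I (c * b : k) by exact: (subZ hI).
have [d _ db] : cyc ((c * b : k) : k^o) b.
  rewrite (Imin (cyc ((c * b : k) : k^o))) //.
    split; first exact: submodule_cyc.
    by move=> /(_ _ (cyc_id _)).
  exact: cyc_sub.
by exists d.
Qed.

(** The annihilator is a prime ideal of an artinian ring, hence maximal. *)
Lemma annihilator_inverse (c : k) : ~ m c -> exists d : k, m (1 - d * c).
Proof.
have [b [mb bP]] := annihilator_separator => mc.
have [d bE] := bP c mc; exists d; apply: annihilator_prime mb.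
rewrite mulrBl mul1r -mulrA -bE subrr => x; exact: scale0r.
Qed.

Lemma annihilator_local : maximal_submodule (k^o : lmodType k) m.
Proof.
have hm := submodule_annihilator.
split=> //; split.
  by split=> // /(_ 1 Logic.I)/(_ xi0); rewrite scale1r.
move=> W hW mW _; have [Wm|/not_subset[c Wc mc]] := pselect (W `<=` m).
  by left; apply/seteqP.
right; apply: subsetT_eq => x _; have [d md] := annihilator_inverse mc.
have W1 : W 1.
  rewrite -[1 : k^o](subrK (d * c : k^o)).
  exact: (subD hW (mW _ md) (subZ hW d Wc)).
by rewrite -[x]mulr1; exact: (subZ hW (x : k)).
Qed.

Context (T1 J : lmodType k) (p1 : {linear (k^o : lmodType k) -> T1})
  (i1 : {linear T1 -> J}).
Hypotheses (p1S : surjective_map p1)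
  (p1k : kernel p1 = radical (k^o : lmodType k)) (i1E : injective_envelope i1).

Local Notation torsion j := (forall c : k, m c -> c *: (j : J) = 0).

(** The class of the b of [annihilator_separator] spans the m-torsion of
    k / rad k, which is all the m-torsion of J as J is essential over k / rad k. *)
Lemma torsion_line : exists j0 : J, [/\ j0 <> 0, torsion j0 &
  forall j, torsion j -> exists d : k, j = d *: j0].
Proof.
have [_ /injectiveP i1I i1e] := i1E.
have hm := submodule_annihilator.
have [b [mb bP]] := annihilator_separator.
have p1Z (c d : k) : p1 (c * d : k) = c *: p1 (d : k^o).
  change (p1 (c *: (d : k^o)) = c *: p1 (d : k^o)); exact: linearZ.
have p10 (x : k) : p1 (x : k^o) = 0 <-> radical (k^o : lmodType k) x.
  by rewrite -p1k.
have radb (c : k) : m c -> p1 (c * b : k) = 0.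
  move=> mc; apply/p10 => M [hM [[_ MT] Mmax]].
  have [Mm|/not_subset[d Md md]] := pselect (M `<=` m); last first.
    have [e bE] := bP d md.
    apply: (subZ hM c); rewrite bE mulrCA mulrC.
    exact: (subZ hM (e * b) Md).
  have [Me|mT] := Mmax m hm Mm (@subsetT _ _).
    rewrite mulrC; by apply: (subZ hM b); rewrite -Me.
  by case: mb; rewrite mT.
pose j0 := i1 (p1 (b : k^o)).
have j0_neq0 : j0 <> 0.
  move=> /i1I /p10 /(_ _ annihilator_local); exact: mb.
exists j0; split=> //.
  by move=> c mc; rewrite /j0 -linearZ -p1Z radb // linear0.
move=> j tj; have [->|j_neq0] := pselect (j = 0).
  by exists 0; rewrite scale0r.
have [c [x xj cj]] : exists c : k, exists2 x, i1 x = c *: j & c *: j <> 0.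
  apply: contrapT => nc; apply: j_neq0.
  have : cyc j = [set 0]; last first.
    by move=> e; change ([set 0] j); rewrite -e; exact: cyc_id.
  apply: i1e; first exact: submodule_cyc.
  apply: meet_eq0; [exact: submodule_range|exact: submodule_cyc|].
  move=> _ [x _ <-] [c _ cj]; apply: contrapT => ix; apply: nc; exists c.
  by exists x => //; rewrite cj.
have mc : ~ m c by move=> /tj.
have [d md] := annihilator_inverse mc.
have jE : j = i1 (d *: x).
  apply/subr0_eq; rewrite linearZ /= xj scalerA -[X in X - _]scale1r -scalerBl.
  exact: tj.
have [b' b'E] := (surjectiveP _).1 p1S (d *: x).
have [e me] := annihilator_inverse mb.
exists ((b' : k) * e); rewrite /j0 -linearZ jE; congr (i1 _).
rewrite -b'E -p1Z; apply/subr0_eq.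
have -> : p1 b' - p1 ((b' : k) * e * b : k) = p1 ((1 - e * b) * (b' : k) : k).
  rewrite -linearB; congr (p1 _).
  by rewrite mulrBl mul1r -mulrA [in RHS]mulrC mulrA.
by apply: i1I; rewrite p1Z b'E linearZ -jE; exact: tj.
Qed.

Let Y : lmodType A := kdual X J.

Lemma kdualE (a : A) (f : Y) (x : X) :
  ((a *: f : Y) : kdual X J) x = (f : kdual X J) (conv a *: x).
Proof. by []. Qed.

Lemma kdual_linear (f : Y) : linear ((f : kdual X J) : Xk -> J).
Proof.
case: f => f /= /asboolP[fD fZ] c x y.
by rewrite fD; congr (_ + _); exact: fZ.
Qed.

Lemma kdual_intro (f : {linear Xk -> J}) :
  exists g : Y, forall x, (g : kdual X J) x = f x.
Proof.
have fP : (f : X -> J) \in @k_linear k A X J.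
  apply/asboolP; split=> [x y|c x]; first exact: (raddfD f).
  exact: (linZ f c x).
by exists (KDual fP).
Qed.

Lemma kdual_ext (f g : Y) :
  (forall x, (f : kdual X J) x = (g : kdual X J) x) -> f = g.
Proof. by move=> fg; apply: val_inj; apply/funext. Qed.

Lemma kdual_torsion (f : Y) (x : X) : torsion ((f : kdual X J) x).
Proof.
move=> c mc; rewrite -[_ *: _](linZ (lin (kdual_linear f)) c x) /=.
by rewrite mc; exact: (linear0 (lin (kdual_linear f))).
Qed.

(** Injectivity of J extends the map from k xi, a copy of k / m, to the line of
    m-torsion in J. *)
Lemma kdual_nonzero (xi : X) : xi <> 0 ->
  exists f : Y, (f : kdual X J) xi <> 0.
Proof.
move=> xi_neq0; have [j0 [j0_neq0 tj0 _]] := torsion_line.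
have [iJ _ _] := i1E.
have [fx fxE] := free_map (xi : Xk).
have [fj fjE] := free_map j0.
have [K [i [iI ir]]] := submodule_module (submodule_range fx).
have [th thE] : exists h : {linear (k^o : lmodType k) -> K},
    forall x, i (h x) = fx x.
  by apply: lift_inj => // x; rewrite ir; exists x.
have thS : surjective_map th.
  apply/surjectiveP => x; have : range i (i x) by exists x.
  by rewrite ir => -[y _ yx]; exists y; apply: iI; rewrite thE.
have [|h hE] := lift_surj (f := fj) thS.
  move=> c thc; rewrite fjE; apply: tj0.
  by apply: (annihilator_test (x := xi)) => //; rewrite -fxE -thE thc linear0.
have [F FE] := iJ _ _ i h iI.
have [f fE] := kdual_intro F; exists f; rewrite fE.
have -> : xi = i (th 1) by rewrite thE fxE scale1r.
by have /= -> := FE (th 1); rewrite hE fjE scale1r.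
Qed.

Section Density.
Context (f0 : Y).
Hypothesis f0_neq0 : f0 <> 0.
Let W : set Y := cyc f0.
Let hW : submodule W := submodule_cyc f0.
Local Notation ev f x := ((f : kdual X J) x).

Let evP (c : k) (f : Y) (x y : Xk) : ev f (c *: x + y) = c *: ev f x + ev f y.
Proof. exact: kdual_linear. Qed.

Let evZ (c : k) (f : Y) (x : X) : ev ((c%:A : A) *: f : Y) x = c *: ev f x.
Proof. exact: (linZ (lin (kdual_linear f)) c x). Qed.

Lemma dual_line (f g : Y) (x y : X) : ev f x <> 0 ->
  exists c : k, ev g y = c *: ev f x.
Proof.
have [j0 [j0_neq0 tj0 jP]] := torsion_line => fx.
have [d dE] := jP _ (@kdual_torsion f x).
have [e eE] := jP _ (@kdual_torsion g y).
have md : ~ m d by move=> md; apply: fx; rewrite dE tj0.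
have [c mc] := annihilator_inverse md.
exists (e * c); rewrite eE dE scalerA -mulrA -scalerA; congr (_ *: _).
by apply/subr0_eq; rewrite -[X in X - _]scale1r -scalerBl; exact: tj0.
Qed.

Let kills (f : Y) (s : seq X) := forall x, x \in s -> ev f x = 0.

(** Linear independence over k / m, phrased without linear combinations.  If some
    w1 in W kills s but not the next vector z, subtract from x the multiple
    of z that makes w1 vanish. *)
Lemma kills_density (s : seq X) (x : X) :
  (forall w : Y, W w -> kills w s -> ev w x = 0) ->
  forall f : Y, kills f s -> ev f x = 0.
Proof.
elim: s x => [|z s IHs] x Wx f fs.
  suff -> : x = 0 by exact: (linear0 (lin (kdual_linear f))).
  apply: contrapT => x0; apply: f0_neq0; apply: kdual_ext => y.
  have [b ->] := X_simple y x0; rewrite -kdualE.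
  exact: (Wx (b *: f0) (subZ hW b (cyc_id f0))).
have fs' : kills f s by move=> y ys; apply: fs; rewrite inE ys orbT.
have fz : ev f z = 0 by apply: fs; rewrite inE eqxx.
have [Wz|] := pselect (forall w : Y, W w -> kills w s -> ev w z = 0).
  apply: IHs fs' => w Ww ws; apply: Wx => // y; rewrite inE.
  by move=> /orP[/eqP ->|/ws //]; exact: Wz.
move=> /existsNP[w1 /not_implyP[Ww1 /not_implyP[w1s w1z]]].
have [c cE] := dual_line w1 x w1z.
have ev_sub (g : Y) : ev g (- (c *: (z : Xk)) + (x : Xk)) = ev g x - c *: ev g z.
  by rewrite -scaleNr evP scaleNr addrC.
suff : ev f (- (c *: (z : Xk)) + (x : Xk)) = 0.
  by rewrite ev_sub fz scaler0 subr0.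
apply: IHs fs' => w Ww ws; rewrite ev_sub.
have [d dE] := dual_line w z w1z.
have : ev (w - ((d%:A : A) *: w1) : Y) x = 0.
  apply: Wx; first by apply: (subB hW) => //; exact: (subZ hW).
  move=> y; rewrite inE => /orP[/eqP ->|ys].
    by change (ev w z - ev ((d%:A : A) *: w1 : Y) z = 0);
       rewrite evZ dE subrr.
  change (ev w y - ev ((d%:A : A) *: w1 : Y) y = 0).
  by rewrite evZ ws // w1s // scaler0 subrr.
change (ev w x - ev ((d%:A : A) *: w1 : Y) x = 0 -> ev w x - c *: ev w z = 0).
by rewrite evZ cE dE !scalerA mulrC.
Qed.

Lemma dual_density (f : Y) (s : seq X) :
  exists2 w : Y, W w & forall x, x \in s -> ev w x = ev f x.
Proof.
elim: s => [|z s [w Ww wf]]; first by exists 0 => //; exact: sub0.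
have [Wz|] := pselect (forall w : Y, W w -> kills w s -> ev w z = 0).
  exists w => // x; rewrite inE => /orP[/eqP ->|/wf //].
  have : ev (f - w : Y) z = 0.
    apply: kills_density Wz _ _ => y ys.
    by change (ev f y - ev w y = 0); rewrite wf // subrr.
  by move=> fw; apply/esym/subr0_eq; exact: fw.
move=> /existsNP[w1 /not_implyP[Ww1 /not_implyP[w1s w1z]]].
have [c cE] := dual_line (f - w) z w1z.
exists (w + (c%:A : A) *: w1); first by apply: (subD hW) => //; exact: (subZ hW).
move=> x; rewrite inE => /orP[/eqP ->|xs].
  change (ev w z + ev ((c%:A : A) *: w1 : Y) z = ev f z).
  rewrite evZ -cE; change (ev w z + (ev f z - ev w z) = ev f z).
  by rewrite addrC subrK.
change (ev w x + ev ((c%:A : A) *: w1 : Y) x = ev f x).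
by rewrite evZ w1s // scaler0 addr0 wf.
Qed.

Lemma dual_generated : W = setT.
Proof.
apply: subsetT_eq => f _; have [n [v vT]] := hA.2.
have [w Ww wf] := dual_density f [seq conv (v i) *: xi0 | i <- enum 'I_n].
suff -> : f = w by [].
apply: kdual_ext => x; have [b ->] := X_simple x xi0_neq0.
have [c ->] := vT b.
have -> : conv (\sum_(i < n) c i *: v i) *: xi0 =
    \sum_(i < n) (c i *: (conv (v i) *: xi0 : Xk) : Xk).
  rewrite -[conv _]/(\sum_(i < n) conv (c i *: v i)) scaler_suml.
  apply: eq_bigr => i _.
  by rewrite -[RHS]/(conv ((c i)%:A : A) *: (conv (v i) *: xi0)) convM
    -scalerAr mulr1.
rewrite -[LHS]/(lin (kdual_linear f) _) -[RHS]/(lin (kdual_linear w) _).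
rewrite !linear_sum; apply: eq_bigr => i _.
by rewrite !linearZ /= wf //; apply/mapP; exists i; rewrite ?mem_enum.
Qed.

End Density.

(** A nonzero submodule W of the dual separates the points of X, since its
    annihilator is a submodule of the simple module X; as X has finite dimension
    over k / m, W is everything. *)
Lemma kdual_simple : simple_module Y.
Proof.
apply/simpleP; split; last exact: dual_generated.
have [f fx] := kdual_nonzero xi0_neq0; exists f => f0; apply: fx.
by rewrite f0.
Qed.

End DualOfSimple.

(** * The Auslander-Reiten translate, gamma and iterated syzygies *)

Section Nakayama.
Context {k : comNzRingType} {A : algType k}.
Hypothesis hA : nakayama_algebra A.
Implicit Types M N K P Q S T Z : lmodType A.

Let artA : artinian_module (A^o : lmodType A) := artin_algebra_artinian hA.1.
Let hN : forall M, fin_gen M -> indecomposable M -> serial M := hA.2.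

Lemma cover_simple_local S P (p : {linear P -> S}) :
  simple_module S -> projective_cover p -> local_at (kernel p).
Proof.
move=> sS [pP pS pk]; have [S0 sS'] := (simpleP S).1 sS; split.
- exact: submodule_ker.
- move=> kT; have [y y0] := S0; apply: y0.
  have [x <-] := (surjectiveP _).1 pS y.
  by change (kernel p x); rewrite kT.
- move=> v pv; apply: pk; first exact: submodule_cyc.
  apply: subsetT_eq => y _; have : [set: S] (p y) by [].
  rewrite -(sS' (p v) pv) => -[b _ py]; exists (y - b *: v).
    by rewrite /kernel /= linearB linearZ /= py subrr.
  by exists (b *: v); [exists b|rewrite subrK].
Qed.

Section MinimalPresentation.
Context (S P0 K P1 : lmodType A) (p : {linear P0 -> S}) (i : {linear K -> P0})
  (c : {linear P1 -> K}).
Hypotheses (sS : simple_module S) (nS : ~ projective S)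
  (pc : projective_cover p) (iI : injective_map i) (ik : range i = kernel p)
  (cc : projective_cover c).

Let SK : is_syzygy S K. Proof. by exists P0, p, i. Qed.

Lemma syzygy_nonprojective_nontrivial : nontrivial K.
Proof. by apply: contrapT => /(syzygy_projective SK). Qed.

Lemma presentation_uniserial : uniserial P1.
Proof.
apply: (cover_uniserial hN cc); apply: (syzygy_uniserial hN SK).
exact: simple_uniserial.
Qed.

Let a : {linear P1 -> P0} := i \o c.

Lemma presentation_range : range a = kernel p.
Proof.
rewrite -ik; apply/seteqP; split=> _ [x _ <-]; first by exists (c x).
have [_ cS _] := cc.
by have [y <-] := (surjectiveP _).1 cS x; exists y.
Qed.

Lemma presentation_nonzero : exists u, a u <> 0.
Proof.
have [x x0] := syzygy_nonprojective_nontrivial.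
have [_ cS _] := cc; have [y yx] := (surjectiveP _).1 cS x.
exists y => /((injectiveP _).1 iI); by rewrite yx.
Qed.

(** D X is simple, and x |-> s(x) y is a nonzero map from P1 onto it as soon as
    the functional y does not vanish at the class of the form s.  So D X is the
    top of P1, which is also the top of K. *)
Lemma DTr_top (X : lmodType A^c) (q : {linear star P1 -> X}) T :
  surjective_map q -> kernel q = range (star_map a) -> is_D X T -> is_top K T.
Proof.
move=> qS qk [T1 [J [[p1 p1S p1k] [i1 i1E] YT]]].
have la : local_at (range a).
  by rewrite presentation_range; exact: cover_simple_local.
have a0 := presentation_nonzero.
have uP1 := presentation_uniserial.
have [pP0 _ _] := pc; have [pP1 cS _] := cc.
have Xs := transpose_simple artA hN pP0 uP1 la a0 qS qk.
have [s [g [u [gs us qg]]]] := transpose_generator pP1 uP1 la a0 qk.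
have sY := kdual_simple hA.1 qg Xs p1S p1k i1E.
have [y yg] := kdual_nonzero hA.1 qg Xs p1S p1k i1E qg.
have K0 := syzygy_nonprojective_nontrivial.
apply/(top_surj _ uP1 K0 cS); apply: (top_iso YT).
have P10 := nontrivial_surj cS K0.
apply/(top_uniserial _ uP1 P10); split=> //.
have [fy fyE] := free_map (y : kdual X J : lmodType A).
exists (fy \o s).
have [r0|//] := simple_submodules sY (submodule_range (fy \o s)).
have sug : conv (s u : A) *: q g = q g.
  rewrite -linearZ; congr (q _); apply: star_ext => x.
  rewrite star_scaleE !gs {2}[x]us linearZ.
  by [].
have fsu : fy (s u) = 0.
  change ([set 0] (fy (s u))); rewrite -r0; by exists u.
case: yg; rewrite -sug -kdualE.
by rewrite -fyE fsu.
Qed.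

End MinimalPresentation.

(** [DTr_top] identifies any translate with the top of any syzygy; conversely a
    translate exists since k / rad k has an injective envelope. *)
Lemma tau_top S K T : simple_module S -> ~ projective S -> is_syzygy S K ->
  is_tau S T <-> is_top K T.
Proof.
move=> sS nS SK.
have uS := simple_uniserial sS.
have uK := syzygy_uniserial hN SK uS.
have K0 : nontrivial K by apply: contrapT => /(syzygy_projective SK).
have tauK T' : is_tau S T' -> is_top K T'.
  move=> [_ _ [X [P0 [K' [P1 [p [i [c [q [pc [iI ik] cc [qS qk]]]]]]]]] XT]].
  have K'T := DTr_top sS nS pc iI ik cc qS qk XT.
  have SK' : is_syzygy S K' by exists P0, p, i.
  have /isomorphicP[f [_ fS]] := syzygy_unique (iso_refl S) SK SK'.
  have K'0 := syzygy_nonprojective_nontrivial nS pc iI ik.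
  exact/(top_surj _ uK K'0 fS).
split; first exact: tauK.
move=> KT; suff [T' ST'] : exists T', is_tau S T'.
  have T'T := top_unique (tauK _ ST') KT.
  have [iS _ [X TrX [T1 [J [T1k JT XT']]]]] := ST'.
  split=> //; exists X => //; exists T1, J; split=> //.
  exact: iso_trans XT' T'T.
have [P0 [p [i [pc iI ik]]]] := SK.
have [P1 [c cc]] := PC_exists artA hN uK K0.
have [X [q [qS qk]]] :=
  quotient_module (submodule_range (lin (star_map_linear (i \o c)))).
have [T1 T1k] := top_exists (k^o : lmodType k).
have [J T1J] := IE_exists T1.
exists (kdual X J); split=> //.
  exact: chain_indecomposable uS.1 (simple_nontrivial sS).
exists X; first by exists P0, K, P1, p, i, c, q.
by exists T1, J; split=> //; exact: iso_refl.
Qed.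

Lemma syzygy_nontrivial_base M K :
  is_syzygy M K -> nontrivial K -> nontrivial M.
Proof.
move=> [P [p [i [[pP pS pk] iI ik]]]] /(nontrivial_inj iI)/nontrivialP P0.
apply: contrapT => M0; apply: P0; apply: pk; first exact: submodule0.
apply: subsetT_eq => x _; exists x; first exact: (trivialP M0).
by exists 0; rewrite ?addr0.
Qed.

(** The kernel of P -> M is the image of the kernel of P(Z) -> Z under a lift
    P(Z) -> P of Z -> M: the range of the lift is comparable with that kernel and
    not contained in it. *)
Lemma top_syzygy_socle M K Z KZ T (j : {linear Z -> M}) :
  uniserial M -> simple_module Z -> injective_map j -> is_syzygy M K ->
  nontrivial K -> is_syzygy Z KZ ->
  nontrivial KZ /\ (is_top K T <-> is_top KZ T).
Proof.
move=> uM sZ jI MK K0 ZKZ.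
have uKZ := syzygy_uniserial hN ZKZ (simple_uniserial sZ).
have [P [p [i [pc iI ik]]]] := MK.
have uP := cover_uniserial hN pc uM.
have [pP pS pk] := pc.
have [P' [p' [i' [[pP' p'S pk'] iI' ik']]]] := ZKZ.
have [f fE] := pP' _ _ p (j \o p') pS.
have fE' x : p (f x) = j (p' x) by exact: fE.
have [h hE] : exists h : {linear KZ -> K}, forall x, i (h x) = (f \o i') x.
  apply: lift_inj => // x; rewrite ik /kernel /= fE'.
  have -> : p' (i' x) = 0 by change (kernel p' (i' x)); rewrite -ik'; exists x.
  exact: linear0.
have kf : kernel p `<=` range f.
  have [fk|//] := uP.1 _ _ (submodule_range f) (submodule_ker p).
  have [z z0] := simple_nontrivial sZ; case: z0; apply: ((injectiveP _).1 jI).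
  have [x <-] := (surjectiveP _).1 p'S z; rewrite -fE'.
  by change (kernel p (f x)); apply: fk; exists x.
have hS : surjective_map h.
  apply/surjectiveP => y.
  have iy : kernel p (i y) by rewrite -ik; exists y.
  have [x _ xy] := kf _ iy.
  have : range i' x.
    rewrite ik'; apply: ((injectiveP _).1 jI); rewrite -fE' xy; exact: iy.
  by move=> [z _ zx]; exists z; apply: iI; rewrite hE /= zx.
by split; [exact: nontrivial_surj hS K0|exact: top_surj uKZ K0 hS].
Qed.

(** The cover of M also covers its top T, so it is a copy of P; K embeds in it. *)
Lemma socle_syzygy M K T P Z : uniserial M -> nontrivial M -> is_syzygy M K ->
  nontrivial K -> is_top M T -> is_PC T P -> is_soc K Z <-> is_soc P Z.
Proof.
move=> uM M0 [P' [p [i [pc iI _]]]] K0 MT TP.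
have uP' := cover_uniserial hN pc uM.
have [sT [q qS]] := (top_uniserial T uM M0).1 MT.
have [pP' pS _] := pc.
have TP' : is_PC T P'.
  have qpS := surjective_comp pS qS.
  exists (q \o p); split=> //.
  apply: (chain_superfluous uP'.1); first exact: submodule_ker.
  have [y y0] := simple_nontrivial sT => kT; apply: y0.
  have [x <-] := (surjectiveP _).1 qpS y.
  by change (kernel (q \o p) x); rewrite kT.
have P'P := PC_iso (iso_refl T) TP' TP.
have /isomorphicP[f [fI _]] := P'P.
rewrite (soc_inj Z uP' K0 iI).
exact: soc_inj (uniserial_iso P'P uP') (nontrivial_inj iI K0) fI.
Qed.

(** With Z the common socle of K1 and of the cover of T0, both sides describe the
    top of the syzygy of Z. *)
Lemma gamma_top M K1 K2 T0 T : uniserial M -> is_syzygy M K1 ->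
  is_syzygy K1 K2 -> nontrivial K2 -> is_top M T0 ->
  is_gamma T0 T <-> is_top K2 T.
Proof.
move=> uM MK1 K1K2 K20 MT0.
have K10 := syzygy_nontrivial_base K1K2 K20.
have M0 := syzygy_nontrivial_base MK1 K10.
have uK1 := syzygy_uniserial hN MK1 uM.
have [sT0 _] := (top_uniserial T0 uM M0).1 MT0.
have tauZ Z T' : is_soc K1 Z -> is_tau Z T' <-> is_top K2 T'.
  move=> K1Z; have [sZ [j jI]] := (soc_uniserial Z uK1 K10).1 K1Z.
  have [KZ ZKZ] :=
    syzygy_exists artA hN (simple_uniserial sZ) (simple_nontrivial sZ).
  have [KZ0 ->] := top_syzygy_socle T' uK1 sZ jI K1K2 K20 ZKZ.
  apply: tau_top => //.
  by move=> /(syzygy_projective ZKZ).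
split.
  move=> [_ [P T0P [Z PZ /tauZ]]]; apply.
  exact/(socle_syzygy Z uM M0 MK1 K10 MT0 T0P).
move=> K2T; split=> //.
have [P T0P] :=
  PC_exists artA hN (simple_uniserial sT0) (simple_nontrivial sT0).
have [Z K1Z] := soc_exists K1.
exists P => //; exists Z; last exact/tauZ.
exact/(socle_syzygy Z uM M0 MK1 K10 MT0 T0P).
Qed.

Lemma syzygy_iter_uniserial M K n :
  uniserial M -> rel_iter n is_syzygy M K -> uniserial K.
Proof.
move=> uM; elim: n K => [|n IHn] K /=; first by move=> /uniserial_iso; apply.
by move=> [K' /IHn uK' K'K]; exact: syzygy_uniserial K'K uK'.
Qed.

(** The iteration of [gamma_top], from the b-th syzygy K0 on; M = IS calls for
    b = 0 and M = S for b = 1. *)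
Lemma gamma_iter_top M b t K : uniserial M ->
  rel_iter (2 * t + b) is_syzygy M K -> nontrivial K ->
  exists K0, [/\ rel_iter b is_syzygy M K0, nontrivial K0 &
    forall T0, is_top K0 T0 ->
      forall T, rel_iter t is_gamma T0 T <-> is_top K T].
Proof.
move=> uM; elim: t K => [|t IHt] K.
  rewrite muln0 add0n => MK K0; exists K; split=> // T0 KT0 T; split.
    by move=> T0T; exact: top_iso KT0.
  exact: top_unique.
rewrite mulnS !addSn /= => -[K1 [K' MK' K'K1] K1K] K0.
have K'0 : nontrivial K'.
  exact/(syzygy_nontrivial_base K'K1)/(syzygy_nontrivial_base K1K).
have uK' := syzygy_iter_uniserial uM MK'.
have [L [ML L0 LP]] := IHt K' MK' K'0.
exists L; split=> // T0 LT0 T; split.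
  by move=> [T' /(LP _ LT0) K'T' /(gamma_top _ uK' K'K1 K1K K0 K'T')].
move=> KT; have [T' K'T'] := top_exists K'; exists T'; first exact/(LP _ LT0).
exact/(gamma_top _ uK' K'K1 K1K K0 K'T').
Qed.

Lemma syzygy_iter_exists M n : uniserial M -> nontrivial M ->
  ((n%:Z)%:E <= pd M)%E -> exists K, rel_iter n is_syzygy M K.
Proof.
move=> uM M0; elim: n => [|n IHn] pdM; first by exists M; exact: iso_refl.
have pdM' : ((n%:Z)%:E <= pd M)%E.
  by apply: le_trans pdM; rewrite lee_fin lez_nat.
have [K MK] := IHn pdM'.
have K0 := syzygy_nontrivial M0 pdM' MK.
have [K' KK'] := syzygy_exists artA hN (syzygy_iter_uniserial uM MK) K0.
by exists K', K.
Qed.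

(** [is_e] chooses some envelope; the value does not depend on it. *)
Lemma is_eP S Q n : is_e S n -> is_IE S Q ->
  Order.min (pd S) (pd Q) = (n%:Z)%:E.
Proof. by move=> [Q' SQ' <-] SQ; rewrite (pd_iso (IE_unique SQ SQ')). Qed.

Lemma is_e_unique S n n' : is_e S n -> is_e S n' -> n = n'.
Proof. by move=> [Q SQ Qn] /is_eP/(_ SQ); rewrite Qn => -[]. Qed.

Lemma is_e_pd S Q n : is_e S n -> is_IE S Q ->
  ((n%:Z)%:E <= pd S)%E /\ ((n%:Z)%:E <= pd Q)%E.
Proof.
move=> Sn SQ; rewrite -(is_eP Sn SQ).
by split; rewrite ge_min lexx ?orbT.
Qed.

Lemma top_isol M N T : uniserial M -> nontrivial M -> isomorphic M N ->
  is_top M T -> is_top N T.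
Proof.
move=> uM M0 MN; have /isomorphicP[f [_ fS]] := MN.
by move=> MT; apply/(top_surj T uM (nontrivial_iso MN M0) fS).
Qed.

Lemma IE_nontrivial S Q : simple_module S -> is_IE S Q -> nontrivial Q.
Proof.
move=> /simple_nontrivial S0 [i [_ iI _]]; exact: nontrivial_inj iI S0.
Qed.

Lemma same_even S t : simple_module S -> is_e S (2 * t) ->
  same_module (is_h S) (rel_comp is_phi (rel_iter t is_gamma) S).
Proof.
move=> sS Se; have oddt : odd (2 * t) = false by rewrite oddM.
have key M T0 K : is_IE S M -> rel_iter (2 * t) is_syzygy M K ->
    is_top M T0 -> forall T, rel_iter t is_gamma T0 T <-> is_top K T.
  move=> SM MK MT0; have uM := IE_uniserial artA hN sS SM.
  have M0 := IE_nontrivial sS SM.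
  have K0 := syzygy_nontrivial M0 (is_e_pd Se SM).2 MK.
  have [|L [ML L0 LP]] := @gamma_iter_top M 0 t K uM _ K0; first by rewrite addn0.
  by apply: LP; exact: top_isol MT0.
have [Q SQ _] := Se.
have uQ := IE_uniserial artA hN sS SQ; have Q0 := IE_nontrivial sS SQ.
have [K QK] := syzygy_iter_exists uQ Q0 (is_e_pd Se SQ).2.
have [T0 QT0] := top_exists Q.
have [T KT] := top_exists K.
split.
- exists T, (2 * t)%N => //; exists Q; first by rewrite /is_N oddt.
  by exists K.
- exists T, T0; first by split=> //; exists Q.
  exact/(key Q T0 K).
move=> X Y [n Sn [M]]; rewrite (is_e_unique Sn Se) /is_N oddt.
move=> SM [K' MK' K'X] [T0' [_ [M' SM' M'T0'] T0'Y]].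
have MT0' : is_top M T0'.
  apply: top_isol M'T0'; last exact: IE_unique SM.
    exact: IE_uniserial SM'.
  exact: IE_nontrivial SM'.
exact: top_unique K'X ((key M T0' K' SM MK' MT0' Y).1 T0'Y).
Qed.

Lemma same_odd S t : simple_module S -> is_e S (2 * t + 1) ->
  same_module (is_h S) (rel_comp is_tau (rel_iter t is_gamma) S).
Proof.
move=> sS Se; have oddt : odd (2 * t + 1) by rewrite oddD oddM.
have key M T0 K : isomorphic S M -> rel_iter (2 * t + 1) is_syzygy M K ->
    is_tau S T0 -> forall T, rel_iter t is_gamma T0 T <-> is_top K T.
  move=> SM MK ST0; have [Q SQ _] := Se.
  have uM := uniserial_iso SM (simple_uniserial sS).
  have M0 := nontrivial_iso SM (simple_nontrivial sS).
  have pdM := (is_e_pd Se SQ).1; rewrite (pd_iso SM) in pdM.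
  have K0 := syzygy_nontrivial M0 pdM MK.
  have [L [[M' MM' M'L] L0 LP]] := gamma_iter_top uM MK K0.
  apply: LP.
  have SL : is_syzygy S L.
    apply: syzygy_isol M'L; exact: iso_sym (iso_trans SM MM').
  by have [_ nS _] := ST0; apply/(tau_top T0 sS nS SL).
have [Q SQ _] := Se.
have S0 := simple_nontrivial sS; have uS := simple_uniserial sS.
have pdS := (is_e_pd Se SQ).1.
have [K SK] := syzygy_iter_exists uS S0 pdS.
have [T KT] := top_exists K.
have [T0 ST0] : exists T0, is_tau S T0.
  have [L SL] := syzygy_exists artA hN uS S0.
  have nS : ~ projective S.
    move=> /resolution_projective/(pd_le_resolution pdS).
    by rewrite addn1.
  have [T0 LT0] := top_exists L; exists T0; exact/(tau_top T0 sS nS SL).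
split.
- exists T, (2 * t + 1)%N => //; exists S; last by exists K.
  by rewrite /is_N oddt; exact: iso_refl.
- by exists T, T0 => //; exact/(key S T0 K (iso_refl S)).
move=> X Y [n Sn [M]]; rewrite (is_e_unique Sn Se) /is_N oddt.
move=> SM [K' MK' K'X] [T0' ST0' T0'Y].
exact: top_unique K'X ((key M T0' K' SM MK' ST0' Y).1 T0'Y).
Qed.

End Nakayama.

Theorem proposition4p4 (k : comNzRingType) (A : algType k)
    (hA : nakayama_algebra A) (S : lmodType A) (hS : simple_module S) (t : nat) :
  (is_e S (2 * t) ->
     same_module (is_h S) (rel_comp is_phi (rel_iter t is_gamma) S)) /\
  (is_e S (2 * t + 1) ->
     same_module (is_h S) (rel_comp is_tau (rel_iter t is_gamma) S)).
Proof. by split; [exact: same_even|exact: same_odd]. Qed.
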